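(* Let $G$ be a countable group with a minimal non-elementary convergence group action $(\rho,X)$. Then the following are equivalent: (i) the action $(\rho,X)$ is effective; (ii) $G$ is a Powers group; (iii) the reduced $C^*$-algebra of $G$ is simple; (iv) the reduced $C^*$-algebra of $G$ has a unique normalized trace; (v) $G$ has infinite conjugacy classes, i.e. the conjugacy class of every element of $G\setminus\{1\}$ is infinite; (vi) $G$ does not have non-trivial amenable normal subgroups; (vii) $G$ does not have non-trivial finite normal subgroups; (viii) all minimal non-elementary convergence group actions of $G$ are effective.
   Context: Convergence group action: Let $G$ be a countable group, $X$ a compact metrizable space and $\rho:G\to \mathrm{Homeo}(X)$ a homomorphism. The pair $(\rho,X)$ is a convergence group action of $G$ if $X$ has at least three points and, for any infinite sequence $\{g_i\}$ of mutually different elements of $G$, there exist a subsequence $\{g_{i_j}\}$ and two (possibly equal) points $r,a\in X$ such that $\rho(g_{i_j})|_{X\setminus\{r\}}$ converges to (the constant map) $a$ uniformly on compact subsets of $X\setminus\{r\}$ and $\rho(g_{i_j}^{-1})|_{X\setminus\{a\}}$ converges to $r$ uniformly on compact subsets of $X\setminus\{a\}$. Such a sequence $\{g_{i_j}\}$ is called a convergence sequence, with repelling point $r$ and attracting point $a$. The limit set $\Lambda(\rho)\subset X$ is the set of all repelling points and attracting points of convergence sequences of $(\rho,X)$. The action is non-elementary if $\Lambda(\rho)$ is infinite. It is minimal if every $\rho(G)$-orbit is dense in $X$, and effective if $\rho$ is injective. Powers group: A group $G$ is a Powers group if $G\neq\{1\}$ and, for every finite subset $F\subset G\setminus\{1\}$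 and every integer $N\ge 1$, there exist a partition $G=C\sqcup D$ and elements $\gamma_1,\dots,\gamma_N\in G$ such that $fC\cap C=\emptyset$ for all $f\in F$ and $\gamma_jD\cap\gamma_kD=\emptyset$ for all $j\neq k$ in $\{1,\dots,N\}$. The reduced $C^*$-algebra of $G$ is the norm closure of the linear span of the left regular representation of $G$ on $\ell^2(G)$. It is simple if it has no non-trivial closed two-sided ideals. A normalized trace on a unital $C^*$-algebra $A$ is a positive linear functional $\tau$ on $A$ with $\tau(1)=1$ and $\tau(xy)=\tau(yx)$ for all $x,y\in A$. *)

(* Defs.v *)
From HB Require Import structures.
From mathcomp Require Export all_boot all_order all_algebra.
From mathcomp Require Export all_classical all_reals all_analysis.
From mathcomp Require Export complex.
From mathcomp Require Import ring.

Set Implicit Arguments.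
Unset Strict Implicit.
Unset Printing Implicit Defensive.

Import Order.TTheory GRing.Theory Num.Theory.
Import numFieldNormedType.Exports.

Local Open Scope classical_set_scope.
Local Open Scope ring_scope.
Local Open Scope complex_scope.

Section Groups.
Variable G : groupType.
Implicit Types (H C D F : set G).

Definition translate (g : G) C : set G := [set (g * c)%g | c in C].

Definition powers_group : Prop :=
  (exists g : G, g != 1%g) /\
  forall (F : set G) (N : nat), finite_set F -> ~ F 1%g -> (1 <= N)%N ->
  exists (C D : set G) (gamma : 'I_N -> G),
    [/\ C `|` D = [set: G], C `&` D = set0,
        forall f, F f -> translate f C `&` C = set0 &
        forall j k, j != k ->
          translate (gamma j) D `&` translate (gamma k) D = set0].

Definition conj_class (g : G) : set G := [set (g ^ x)%g | x in [set: G]].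

Definition icc : Prop := forall g : G, g != 1%g -> infinite_set (conj_class g).

Record normal_subgroup H : Prop := NormalSubgroup {
  normal_subgroup1 : H 1%g;
  normal_subgroupM : forall x y, H x -> H y -> H (x * y)%g;
  normal_subgroupV : forall x, H x -> H (x^-1)%g;
  normal_subgroupJ : forall x y, H x -> H (x ^ y)%g }.

(* Amenability of a subgroup H as a discrete group: a finitely additive
   left-invariant probability measure m on the subsets of H; the values of m
   on the other subsets of G are irrelevant. *)
Definition amenable (R : realType) H : Prop :=
  exists m : set G -> R,
    [/\ m H = 1,
        forall A, A `<=` H -> 0 <= m A,
        forall A B, A `<=` H -> B `<=` H -> A `&` B = set0 ->
          m (A `|` B) = m A + m B &
        forall h A, H h -> A `<=` H -> m (translate h A) = m A].

End Groups.

Section ConvergenceActions.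
(* A compact metrizable space is presented with a compatible metric; by
   compactness, uniform convergence does not depend on this choice. *)
Variables (R : realType) (G : groupType) (X : metricType R).
Implicit Types (rho : G -> X -> X) (u : nat -> G).

Definition homeomorphism (f : X -> X) : Prop :=
  exists f' : X -> X,
    [/\ cancel f f', cancel f' f, continuous f & continuous f'].

Definition homeo_action rho : Prop :=
  (forall g, homeomorphism (rho g)) /\
  (forall g h, rho (g * h)%g = rho g \o rho h).

Definition convergence_seq rho u (r a : X) : Prop :=
  [/\ injective u,
      {family compactly_in (~` [set r]),
        (rho \o u) @ \oo --> (fun=> a : X)} &
      {family compactly_in (~` [set a]),
        (fun n => rho (u n)^-1%g) @ \oo --> (fun=> r : X)}].

Record convergence_action rho : Prop := ConvergenceAction {
  conv_compact : compact [set: X];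
  conv_homeo : homeo_action rho;
  conv_three_points : exists x y z : X, [/\ x != y, y != z & x != z];
  conv_subseq : forall u, injective u ->
    exists (phi : nat -> nat) (r a : X),
      {homo phi : m n / (m < n)%N} /\ convergence_seq rho (u \o phi) r a }.

Definition limit_set rho : set X :=
  [set x | exists u r a, convergence_seq rho u r a /\ (x = r \/ x = a)].

Definition non_elementary rho : Prop := infinite_set (limit_set rho).

Definition minimal_action rho : Prop :=
  forall x : X, dense [set rho g x | g in [set: G]].

Definition effective rho : Prop := injective rho.

End ConvergenceActions.

Section Ell2.
Variables (R : realType) (G : groupType).
Local Notation C := R[i].
Local Notation normc := ComplexField.Normc.normc.

Definition sqnorm (f : G -> C) : \bar R :=
  \esum_(g in [set: G]) (normc (f g) ^+ 2)%:E.

Definition square_summable : {pred (G -> C)} := fun f => `[< (sqnorm f < +oo)%E >].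

Fact sqnorm_ge0 f : (0 <= sqnorm f)%E.
Proof. by apply: esum_ge0 => g _; rewrite lee_fin sqr_ge0. Qed.

Fact normcD_le (x y : C) :
  normc (x + y) ^+ 2 <= 2 * normc x ^+ 2 + 2 * normc y ^+ 2.
Proof.
case: x y => [a b] [c d] /=; rewrite !sqr_sqrtr ?addr_ge0 ?sqr_ge0 //.
rewrite -subr_ge0.
rewrite (_ : _ - _ = (a - c) ^+ 2 + (b - d) ^+ 2) ?addr_ge0 ?sqr_ge0 //.
by ring.
Qed.

Fact esumZ_le (c : R) (u : G -> R) : 0 <= c -> (forall g, 0 <= u g) ->
  (\esum_(g in [set: G]) (c * u g)%:E <=
   c%:E * \esum_(g in [set: G]) (u g)%:E)%E.
Proof.
move=> c0 u0; apply: ge_ereal_sup => _ [A [finA _] <-].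
have -> : (\sum_(x \in A) (c * u x)%:E = c%:E * \sum_(x \in A) (u x)%:E)%E.
  rewrite ge0_mule_fsumr; last by move=> x; rewrite lee_fin.
  by apply: eq_fsbigr => x _; rewrite EFinM.
by apply: lee_wpmul2l; [rewrite lee_fin | apply: esum_ge; exists A].
Qed.

Fact square_summable_closed : submod_closed square_summable.
Proof.
split; first apply/asboolP.
  rewrite /sqnorm esum1 ?ltry // => g _.
  by rewrite ComplexField.Normc.normc0 expr0n.
move=> c f h /asboolP sf /asboolP sh; apply/asboolP.
pose M := 2 * normc c ^+ 2.
have M0 : 0 <= M by rewrite mulr_ge0 ?sqr_ge0.
apply: (@le_lt_trans _ _ (M%:E * sqnorm f + 2%:E * sqnorm h)%E); last first.
  by rewrite lte_add_pinfty // lte_mul_pinfty // ?lee_fin.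
apply: (@le_trans _ _ (\esum_(g in [set: G])
    ((M * normc (f g) ^+ 2)%:E + (2 * normc (h g) ^+ 2)%:E))%E).
  apply: le_esum => g _; rewrite -EFinD lee_fin.
  apply: le_trans (normcD_le _ _) _.
  by rewrite /= [(c *: f) g]/(c * f g) ComplexField.Normc.normcM exprMn mulrA.
rewrite esumD; last 2 first.
- by move=> g _; rewrite lee_fin mulr_ge0 ?sqr_ge0.
- by move=> g _; rewrite lee_fin mulr_ge0 ?sqr_ge0.
by apply: leeD; apply: esumZ_le => // g; rewrite sqr_ge0.
Qed.

HB.instance Definition _ := GRing.isSubmodClosed.Build C (G -> C)
  square_summable square_summable_closed.

Record ell2 := Ell2 {
  ell2_fun :> G -> C;
  _ : ell2_fun \in square_summable }.

HB.instance Definition _ := [isSub for ell2_fun].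
HB.instance Definition _ := [Choice of ell2 by <:].
HB.instance Definition _ := [SubChoice_isSubLmodule of ell2 by <:].

Implicit Types f h : ell2.

Definition ell2_norm f : R := Num.sqrt (fine (sqnorm f)).

(* The sum over G of an absolutely summable family. *)
Definition rsum (u : G -> R) : R :=
  fine (\esum_(g in [set: G]) (u^\+ g)%:E) -
  fine (\esum_(g in [set: G]) (u^\- g)%:E).

Definition csum (u : G -> C) : C :=
  rsum (fun g => complex.Re (u g)) +i* rsum (fun g => complex.Im (u g)).

Definition ell2_dot f h : C := csum (fun g => f g * (h g)^*).

Fact left_regular_subproof (x : G) f :
  (fun g => f (x^-1 * g)%g) \in square_summable.
Proof.
case: f => f /= /asboolP sf; apply/asboolP; rewrite /sqnorm.
move: sf; congr (_ < _)%E; rewrite /sqnorm.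
rewrite (reindex_esum [set: G] [set: G] (fun g => x^-1 * g)%g) //.
split => //; first by move=> a b _ _; apply: mulgI.
by move=> y _; exists (x * y)%g; rewrite // mulKg.
Qed.

Definition left_regular (x : G) : ell2 -> ell2 :=
  fun f => Ell2 (left_regular_subproof x f).

Implicit Types (S T : ell2 -> ell2) (E I : set (ell2 -> ell2)).

Definition bounded_operator T : Prop :=
  linear T /\ exists M : R, forall f, ell2_norm (T f) <= M * ell2_norm f.

(* The last conjunct says that the operator norm of T - S is at most eps. *)
Definition norm_closure E : set (ell2 -> ell2) :=
  [set T | bounded_operator T /\
    forall eps : R, 0 < eps ->
      exists S, E S /\ forall f, ell2_norm (T f - S f) <= eps * ell2_norm f].

Definition left_regular_span : set (ell2 -> ell2) :=
  [set T | exists s : seq (C * G), T = \sum_(p <- s) p.1 *: left_regular p.2].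

Definition reduced_Cstar : set (ell2 -> ell2) := norm_closure left_regular_span.

Record closed_ideal I : Prop := ClosedIdeal {
  ideal_sub : I `<=` reduced_Cstar;
  ideal0 : I 0;
  ideal_linear : forall (c : C) S T, I S -> I T -> I (c *: S + T);
  ideal_mull : forall S T, reduced_Cstar S -> I T -> I (S \o T);
  ideal_mulr : forall S T, I S -> reduced_Cstar T -> I (S \o T);
  ideal_closed : norm_closure I `<=` I }.

Definition reduced_Cstar_simple : Prop :=
  forall I, closed_ideal I -> I = [set 0] \/ I = reduced_Cstar.

Definition adjoint T S : Prop :=
  forall f h, ell2_dot (T f) h = ell2_dot f (S h).

(* Only the values of tau on the reduced C*-algebra are constrained. *)
Record normalized_trace (tau : (ell2 -> ell2) -> C) : Prop := NormalizedTrace {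
  trace_linear : forall (c : C) S T, reduced_Cstar S -> reduced_Cstar T ->
    tau (c *: S + T) = c * tau S + tau T;
  trace_pos : forall S T, reduced_Cstar T -> reduced_Cstar S -> adjoint T S ->
    0 <= tau (S \o T);
  trace1 : tau idfun = 1;
  traceC : forall S T, reduced_Cstar S -> reduced_Cstar T ->
    tau (S \o T) = tau (T \o S) }.

Definition reduced_Cstar_unique_trace : Prop :=
  exists tau, normalized_trace tau /\
    forall tau', normalized_trace tau' ->
      forall T, reduced_Cstar T -> tau' T = tau T.

End Ell2.

(* Main.v *)
(** The implications (ii) => (iii), (iv), (v), (vi) hold for every Powers group, each of
    (iii), (iv), (v), (vi) forbids nontrivial finite normal subgroups, and the kernel of a
    convergence action is a finite normal subgroup; this closes every cycle through (vii),
    (viii) and (i), except for (i) => (ii).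

    (i) => (ii): a convergence sequence whose repelling point is moved into an open set U
    contracts the complement of U to a point. Translating its attracting point along its
    infinite orbit yields gamma_j that map X \ U to pairwise disjoint sets, so that
    C = {g | g x0 \in U} works as soon as every f in F moves U off itself. Such a U exists
    because the fixed point set of f <> 1 has empty interior.

    (ii) => (iii), (iv): averaging over the conjugates by gamma_1, ..., gamma_N shrinks a
    finitely supported operator with zero trace by a factor 2 / sqrt N. A nonzero ideal
    thus contains elements close to 1, and a bounded trace must be the canonical one;
    positive traces are bounded because 1 - x is a square for self-adjoint x of norm
    at most 1/2.

    Conversely, a finite normal subgroup H gives the ideal of the T with T lambda(h) = T
    for h in H, and the trace T |-> (T 1_H)(1). *)

Require Import Defs.
From mathcomp Require Import ring lra.
From mathcomp Require finmap.

Set Implicit Arguments.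
Unset Strict Implicit.
Unset Printing Implicit Defensive.

Import Order.TTheory GRing.Theory Num.Theory.
Import numFieldNormedType.Exports.

Local Open Scope classical_set_scope.
Local Open Scope ring_scope.
Local Open Scope complex_scope.

Local Notation normc := ComplexField.Normc.normc.

#[local] Arguments ell2_fun : simpl never.
#[local] Arguments ell2_dot : simpl never.

(** * Complex norms and sums over a group *)

Section ComplexNorm.
Variable R : realType.
Implicit Types x y : R[i].

(** Identities in the reduced algebra are checked on the span of the [left_regular g] and passed on
    by density, always in the same form: a quantity bounded by [e * K] for every e > 0 vanishes. The
    other recurring tool is that the algebra commutes with right translations, so that T is
    determined by [T (delta R 1)]. Averages run over conjugates because conjugation by lambda(g)
    preserves every ideal and every trace. Positivity of a trace speaks only of products S T with S
    adjoint to T, and continuity is not part of the definition. Bounding a trace therefore requires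
    adjoints and square roots inside the algebra; both are norm limits, and this is what
    completeness of l^2(G) is for. The functional attached to H sends lambda(g) to 1 or 0 according
    to whether g lies in H; it is tracial because H is normal. *)

Lemma normc_ge0 x : 0 <= normc x.
Proof. by case: x => a b; rewrite sqrtr_ge0. Qed.

Lemma normcC (a : R) : normc a%:C = `|a|.
Proof. by rewrite /= expr0n addr0 sqrtr_sqr. Qed.

Lemma sqr_normcE x : normc x ^+ 2 = complex.Re x ^+ 2 + complex.Im x ^+ 2.
Proof. by case: x => a b; rewrite /= sqr_sqrtr ?addr_ge0 ?sqr_ge0. Qed.

Lemma normc_triangle x y : normc (x + y) <= normc x + normc y.
Proof. by rewrite -lecR rmorphD; apply: (ler_normD x y). Qed.

Lemma normcN x : normc (- x) = normc x.
Proof. by case: x => a b; rewrite /= !sqrrN. Qed.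

Lemma normc_le_ReIm x : normc x <= `|complex.Re x| + `|complex.Im x|.
Proof.
rewrite -(@ler_pXn2r _ 2) ?nnegrE ?addr_ge0 ?normc_ge0 //.
rewrite sqr_normcE sqrrD !real_normK ?num_real // -addrA lerD2l lerDr.
by rewrite mulrn_wge0 // mulr_ge0.
Qed.

Lemma ReIm_le_normc x : `|complex.Re x| <= normc x /\ `|complex.Im x| <= normc x.
Proof.
by split; rewrite -(@ler_pXn2r _ 2) ?nnegrE ?normc_ge0 // sqr_normcE
  real_normK ?num_real // ?lerDl ?lerDr sqr_ge0.
Qed.

Lemma conjcE x : Num.conj x = complex.Re x -i* complex.Im x.
Proof. by case: x. Qed.

Lemma normc_conj x : normc (Num.conj x) = normc x.
Proof. by rewrite conjcE; case: x => a b; rewrite /= sqrrN. Qed.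

Lemma conjcD x y : Num.conj (x + y) = Num.conj x + Num.conj y.
Proof. exact: rmorphD. Qed.

Lemma conjcM x y : Num.conj (x * y) = Num.conj x * Num.conj y.
Proof. exact: rmorphM. Qed.

Lemma conjcN x : Num.conj (- x) = - Num.conj x.
Proof. exact: rmorphN. Qed.

End ComplexNorm.

(** The weight t stays free so that, after summation over G, it can be set to a ratio of norms. *)
Lemma ler_sqrD_weighted (R : realFieldType) (t a b : R) : 0 < t ->
  (a + b) ^+ 2 <= (1 + t) * a ^+ 2 + (1 + t^-1) * b ^+ 2.
Proof.
move=> t0; rewrite -subr_ge0.
have -> : (1 + t) * a ^+ 2 + (1 + t^-1) * b ^+ 2 - (a + b) ^+ 2
  = t^-1 * (t * a - b) ^+ 2 by field; rewrite gt_eqF.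
by rewrite mulr_ge0 ?sqr_ge0 // invr_ge0 ltW.
Qed.

(** * Signed sums over the group as differences of nonnegative sums *)

Section FamilySums.
Variables (R : realType) (G : groupType).
Implicit Types (u v : G -> R).

Lemma esumZ (c : R) u : 0 <= c -> (forall g, 0 <= u g) ->
  (\esum_(g in [set: G]) (c * u g)%:E =
   c%:E * \esum_(g in [set: G]) (u g)%:E)%E.
Proof.
move=> c0 u0; apply/eqP; rewrite eq_le esumZ_le //=.
have [->|cn0] := eqVneq c 0.
  by rewrite mul0e; apply: esum_ge0 => g _; rewrite mul0r.
have cp : 0 < c by rewrite lt_neqAle eq_sym cn0.
(* The reverse inequality is the known one for the factor [c^-1] and the family [c * u]. *)
have := @esumZ_le R G c^-1 (fun g => c * u g).
rewrite invr_ge0 c0 => /(_ isT) => /(_ (fun g => mulr_ge0 c0 (u0 g))).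
move=> /(@lee_wpmul2l _ c%:E); rewrite lee_fin => /(_ c0).
rewrite muleA -EFinM divff // mul1e; apply: le_trans.
by apply: lee_wpmul2l; rewrite ?lee_fin // le_esum // => g _; rewrite mulKf.
Qed.

Lemma esum_ge_at u g : (forall x, 0 <= u x) ->
  ((u g)%:E <= \esum_(x in [set: G]) (u x)%:E)%E.
Proof.
move=> u0; apply: esum_ge; exists [set g]; first by split.
by rewrite fsbig_set1.
Qed.

Definition abs_summable u := (\esum_(g in [set: G]) `|u g|%:E < +oo)%E.

Lemma abs_summable_le u v : (forall g, `|u g| <= v g) ->
  (\esum_(g in [set: G]) (v g)%:E < +oo)%E -> abs_summable u.
Proof.
by move=> uv; apply: le_lt_trans; apply: le_esum => g _; rewrite lee_fin.
Qed.

Lemma esum_fin u : (forall g, 0 <= u g) ->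
  (\esum_(g in [set: G]) (u g)%:E < +oo)%E ->
  \esum_(g in [set: G]) (u g)%:E \is a fin_num.
Proof.
by move=> u0 uo; rewrite ge0_fin_numE //; apply: esum_ge0 => g _; rewrite lee_fin.
Qed.

Lemma fine_esumD u v : (forall g, 0 <= u g) -> (forall g, 0 <= v g) ->
  (\esum_(g in [set: G]) (u g)%:E < +oo)%E ->
  (\esum_(g in [set: G]) (v g)%:E < +oo)%E ->
  fine (\esum_(g in [set: G]) (u g + v g)%:E) =
  fine (\esum_(g in [set: G]) (u g)%:E) + fine (\esum_(g in [set: G]) (v g)%:E).
Proof.
move=> u0 v0 uf vf; rewrite -fineD ?esum_fin // -esumD //.
by move=> g _; rewrite lee_fin. by move=> g _; rewrite lee_fin.
Qed.

Lemma esumD_lty u v : (forall g, 0 <= u g) -> (forall g, 0 <= v g) ->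
  (\esum_(g in [set: G]) (u g)%:E < +oo)%E ->
  (\esum_(g in [set: G]) (v g)%:E < +oo)%E ->
  (\esum_(g in [set: G]) (u g + v g)%:E < +oo)%E.
Proof.
move=> u0 v0 uf vf; under eq_esum do rewrite EFinD.
by rewrite esumD ?lte_add_pinfty // => g _; rewrite lee_fin.
Qed.

Lemma pos_part_ge0 u g : 0 <= u^\+ g.
Proof. by rewrite /funrpos le_max lexx orbT. Qed.

Lemma neg_part_ge0 u g : 0 <= u^\- g.
Proof. by rewrite /funrneg le_max lexx orbT. Qed.

Lemma pos_part_le u g : `|u^\+ g| <= `|u g|.
Proof.
by rewrite /funrpos; case: (lerP (u g) 0) => h; rewrite ?normr0 ?normr_ge0.
Qed.

Lemma neg_part_le u g : `|u^\- g| <= `|u g|.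
Proof.
rewrite /funrneg; case: (lerP (- u g) 0) => h; rewrite ?normr0 ?normr_ge0 //.
by rewrite normrN.
Qed.

Lemma pos_sub_neg u g : u^\+ g - u^\- g = u g.
Proof.
rewrite /funrneg /funrpos; case: (lerP (u g) 0) => h; case: (lerP (-u g) 0) => h'; lra.
Qed.

Lemma pos_part_lty u : abs_summable u ->
  (\esum_(g in [set: G]) (u^\+ g)%:E < +oo)%E.
Proof.
apply: le_lt_trans; apply: le_esum => g _; rewrite lee_fin.
exact: le_trans (ler_norm _) (pos_part_le _ _).
Qed.

Lemma neg_part_lty u : abs_summable u ->
  (\esum_(g in [set: G]) (u^\- g)%:E < +oo)%E.
Proof.
apply: le_lt_trans; apply: le_esum => g _; rewrite lee_fin.
exact: le_trans (ler_norm _) (neg_part_le _ _).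
Qed.

(** Any decomposition of w = u - v into nonnegative summable families computes [rsum w], because w^+
    + v = u + w^- is an identity between nonnegative families. Additivity and homogeneity of [rsum]
    reduce to this. *)
Lemma rsum_sub u v : (forall g, 0 <= u g) -> (forall g, 0 <= v g) ->
  (\esum_(g in [set: G]) (u g)%:E < +oo)%E ->
  (\esum_(g in [set: G]) (v g)%:E < +oo)%E ->
  rsum (fun g => u g - v g) =
  fine (\esum_(g in [set: G]) (u g)%:E) - fine (\esum_(g in [set: G]) (v g)%:E).
Proof.
move=> u0 v0 uf vf; set w := fun g => u g - v g.
have ws : abs_summable w.
  apply: (@abs_summable_le _ (fun g => u g + v g)); last exact: esumD_lty.
  move=> g; apply: le_trans (ler_normB _ _) _.
  by rewrite !ger0_norm.
apply/eqP; rewrite /rsum subr_eq addrAC eq_sym subr_eq; apply/eqP.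
have p0 := pos_part_ge0 w; have n0 := neg_part_ge0 w.
have pf := pos_part_lty ws; have nf := neg_part_lty ws.
rewrite -!fine_esumD //; congr fine; apply: eq_esum => g _; congr EFin.
have := pos_sub_neg w g; rewrite {3}/w; lra.
Qed.

Lemma eq_rsum u v : u =1 v -> rsum u = rsum v.
Proof. by move=> /funext ->. Qed.

Lemma rsum_ge0E u : (forall g, 0 <= u g) ->
  rsum u = fine (\esum_(g in [set: G]) (u g)%:E).
Proof.
move=> u0; rewrite /rsum [X in _ - fine X]esum1 ?subr0; last first.
  by move=> g _; congr EFin; rewrite /funrneg; apply/max_idPr; rewrite oppr_le0.
by congr fine; apply: eq_esum => g _; congr EFin; rewrite /funrpos; apply/max_idPl.
Qed.

Lemma rsum0 : rsum (fun _ : G => 0 : R) = 0.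
Proof. by rewrite rsum_ge0E // esum1. Qed.

Lemma rsumD u v : abs_summable u -> abs_summable v ->
  rsum (fun g => u g + v g) = rsum u + rsum v.
Proof.
move=> us vs.
have p := pos_part_ge0; have n := neg_part_ge0.
rewrite (@eq_rsum _ (fun g => (u^\+ g + v^\+ g) - (u^\- g + v^\- g))); last first.
  by move=> g; have := pos_sub_neg u g; have := pos_sub_neg v g; lra.
rewrite rsum_sub; last 4 first.
- by move=> g; rewrite addr_ge0.
- by move=> g; rewrite addr_ge0.
- by apply: esumD_lty => //; apply: pos_part_lty.
- by apply: esumD_lty => //; apply: neg_part_lty.
rewrite (fine_esumD (p u) (p v) (pos_part_lty us) (pos_part_lty vs)).
rewrite (fine_esumD (n u) (n v) (neg_part_lty us) (neg_part_lty vs)).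
by rewrite /rsum opprD addrACA.
Qed.

Lemma rsumN u : rsum (fun g => - u g) = - rsum u.
Proof.
rewrite /rsum opprB; congr (fine _ - fine _); apply: eq_esum => g _; congr EFin.
by rewrite /funrpos /funrneg /= opprK.
Qed.

Lemma rsumZ c u : abs_summable u -> rsum (fun g => c * u g) = c * rsum u.
Proof.
move=> us; wlog c0 : c / 0 <= c => [hw|].
  have [|c0] := leP 0 c; first exact: hw.
  rewrite -[c]opprK mulNr -hw ?oppr_ge0 ?ltW // -rsumN; apply: eq_rsum => g.
  by rewrite mulNr.
rewrite (@eq_rsum _ (fun g => c * u^\+ g - c * u^\- g)); last first.
  by move=> g; rewrite -{1}(pos_sub_neg u) mulrBr.
have p := pos_part_ge0; have n := neg_part_ge0.
have pf := pos_part_lty us; have nf := neg_part_lty us.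
rewrite rsum_sub; last 4 first.
- by move=> g; rewrite mulr_ge0.
- by move=> g; rewrite mulr_ge0.
- by rewrite esumZ // lte_mul_pinfty // lee_fin.
- by rewrite esumZ // lte_mul_pinfty // lee_fin.
by rewrite !esumZ // !fineM ?esum_fin //= /rsum mulrBr.
Qed.

Lemma rsum_le u v : (forall g, `|u g| <= v g) ->
  (\esum_(g in [set: G]) (v g)%:E < +oo)%E ->
  `|rsum u| <= fine (\esum_(g in [set: G]) (v g)%:E).
Proof.
move=> uv vf; have us := abs_summable_le uv vf.
have v0 g : 0 <= v g by apply: le_trans (uv g).
have p := pos_part_ge0 u; have n := neg_part_ge0 u.
have pf := pos_part_lty us; have nf := neg_part_lty us.
have pe : 0 <= fine (\esum_(g in [set: G]) (u^\+ g)%:E).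
  by apply: fine_ge0; apply: esum_ge0 => g _; rewrite lee_fin.
have ne : 0 <= fine (\esum_(g in [set: G]) (u^\- g)%:E).
  by apply: fine_ge0; apply: esum_ge0 => g _; rewrite lee_fin.
have : fine (\esum_(g in [set: G]) (u^\+ g + u^\- g)%:E) <=
       fine (\esum_(g in [set: G]) (v g)%:E).
  apply: fine_le; rewrite ?esum_fin //.
  - by move=> g; rewrite addr_ge0.
  - exact: esumD_lty.
  apply: le_esum => g _; rewrite lee_fin; apply: le_trans (uv g).
  rewrite /funrneg /funrpos; case: (lerP (u g) 0) => h; case: (lerP (-u g) 0) => h';
   rewrite ?add0r ?addr0 ?normr_ge0 ?ler_norm //.
   - by rewrite -normrN ler_norm.
   - lra.
rewrite fine_esumD // /rsum ler_norml => h; apply/andP; split; lra.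
Qed.

Lemma rsum_supp1 u x : (forall g, g != x -> u g = 0) -> rsum u = u x.
Proof.
move=> ux.
have h (v : G -> R) : (forall g, g != x -> v g = 0) -> (0 <= v x) ->
    fine (\esum_(g in [set: G]) (v g)%:E) = v x.
  move=> vx v0; rewrite (_ : esum _ _ = (v x)%:E) //.
  rewrite -(@esum_set1 _ _ x (fun g => (v g)%:E)) ?lee_fin //.
  rewrite [RHS]esum_mkcond; apply: eq_esum => g _.
  case: ifPn; first by rewrite inE.
  by rewrite notin_setE => /= /eqP /vx ->.
rewrite /rsum !h ?pos_sub_neg ?pos_part_ge0 ?neg_part_ge0 // => g /ux;
 by rewrite /funrneg /funrpos => ->; rewrite ?oppr0 maxxx.
Qed.

End FamilySums.

(** * The Hilbert space *)

Section Ell2Space.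
Variables (R : realType) (G : groupType).
Local Notation C := R[i].
Implicit Types (f h : ell2 R G).

Lemma ell2P f h : (forall g, f g = h g) -> f = h.
Proof. by move=> fh; apply/val_inj/funext. Qed.

Lemma ell2DE f h g : (f + h) g = f g + h g. Proof. by []. Qed.
Lemma ell2NE f g : (- f) g = - f g. Proof. by []. Qed.
Lemma ell2ZE c f g : (c *: f) g = c * f g. Proof. by []. Qed.
Lemma ell20E g : (0 : ell2 R G) g = 0. Proof. by []. Qed.
Lemma ell2BE f h g : (f - h) g = f g - h g. Proof. by []. Qed.

Lemma ell2_sumE (I : Type) (r : seq I) (F : I -> ell2 R G) g :
  (\sum_(i <- r) F i) g = \sum_(i <- r) F i g.
Proof. by elim/big_rec2: _ => // i x y _ <-. Qed.

Lemma sqnorm_lty f : (sqnorm f < +oo)%E.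
Proof. by case: f => f sf; apply/asboolP. Qed.

Lemma ell2_norm_ge0 f : 0 <= ell2_norm f.
Proof. exact: sqrtr_ge0. Qed.

Lemma sqr_ell2_norm f : ell2_norm f ^+ 2 = fine (sqnorm f).
Proof. by rewrite sqr_sqrtr // fine_ge0 // sqnorm_ge0. Qed.

Lemma sqnormE f : sqnorm f = (ell2_norm f ^+ 2)%:E.
Proof. by rewrite sqr_ell2_norm fineK // ge0_fin_numE ?sqnorm_ge0 // sqnorm_lty. Qed.

Lemma ell2_norm_le f (M : R) : 0 <= M -> (sqnorm f <= (M ^+ 2)%:E)%E ->
  ell2_norm f <= M.
Proof.
move=> M0; rewrite sqnormE lee_fin => h.
by rewrite -(@ler_pXn2r _ 2) // nnegrE ell2_norm_ge0.
Qed.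

Lemma ell2_norm_at f g : normc (f g) <= ell2_norm f.
Proof.
rewrite -(@ler_pXn2r _ 2) ?nnegrE ?ell2_norm_ge0 ?normc_ge0 // -lee_fin -sqnormE.
by apply: (@esum_ge_at _ _ (fun x => normc (f x) ^+ 2)) => x; apply: sqr_ge0.
Qed.

Lemma ell2_norm0 : ell2_norm (0 : ell2 R G) = 0.
Proof.
apply/eqP; rewrite eq_le ell2_norm_ge0 andbT; apply: ell2_norm_le => //.
by rewrite /sqnorm esum1 ?expr0n // => g _; rewrite ell20E ComplexField.Normc.normc0 expr0n.
Qed.

Lemma ell2_norm_eq0 f : ell2_norm f = 0 -> f = 0.
Proof.
move=> f0; apply: ell2P => g; apply: ComplexField.Normc.eq0_normc.
by apply/eqP; rewrite eq_le normc_ge0 -{1}f0 ell2_norm_at.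
Qed.

Lemma ell2_normZ c f : ell2_norm (c *: f) = normc c * ell2_norm f.
Proof.
apply: (@pexpIrn _ 2) => //; rewrite ?nnegrE ?mulr_ge0 ?ell2_norm_ge0 ?normc_ge0 //.
rewrite exprMn !sqr_ell2_norm.
have -> : sqnorm (c *: f) = ((normc c ^+ 2)%:E * sqnorm f)%E.
  rewrite -esumZ ?sqr_ge0 //; last by move=> g; apply: sqr_ge0.
  by apply: eq_esum => g _; rewrite ell2ZE ComplexField.Normc.normcM exprMn.
by rewrite fineM // ge0_fin_numE ?sqnorm_ge0 // sqnorm_lty.
Qed.

Lemma ell2_normN f : ell2_norm (- f) = ell2_norm f.
Proof. by rewrite -scaleN1r ell2_normZ normcN ComplexField.Normc.normc1 mul1r. Qed.

(* Weighted AM-GM under the sum, optimized at t = |h| / |f|, replaces Cauchy-Schwarz. *)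
Lemma ell2_normD f h : ell2_norm (f + h) <= ell2_norm f + ell2_norm h.
Proof.
have [/ell2_norm_eq0 ->|fn0] := eqVneq (ell2_norm f) 0.
  by rewrite add0r ell2_norm0 add0r.
have [/ell2_norm_eq0 ->|hn0] := eqVneq (ell2_norm h) 0.
  by rewrite addr0 ell2_norm0 addr0.
have f0 : 0 < ell2_norm f by rewrite lt_neqAle eq_sym fn0 ell2_norm_ge0.
have h0 : 0 < ell2_norm h by rewrite lt_neqAle eq_sym hn0 ell2_norm_ge0.
apply: ell2_norm_le; first by rewrite addr_ge0 ?ell2_norm_ge0.
set a := ell2_norm f in f0 fn0 *; set b := ell2_norm h in h0 hn0 *.
pose t := b / a; have t0 : 0 < t by rewrite divr_gt0.
have -> : ((a + b) ^+ 2)%:E = ((1 + t)%:E * sqnorm f + (1 + t^-1)%:E * sqnorm h)%E.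
  rewrite !sqnormE -!EFinM -EFinD -/a -/b; congr EFin; rewrite /t.
  by field; rewrite fn0 hn0.
have t1 : 0 <= 1 + t by rewrite addr_ge0 // ltW.
have t2 : 0 <= 1 + t^-1 by rewrite addr_ge0 // invr_ge0 ltW.
rewrite -!esumZ //; try by move=> g; apply: sqr_ge0.
rewrite -esumD; try by move=> g _; rewrite lee_fin mulr_ge0 ?sqr_ge0.
apply: le_esum => g _; rewrite -EFinD lee_fin.
apply: le_trans (ler_sqrD_weighted _ _ t0).
by rewrite ler_pXn2r ?nnegrE ?addr_ge0 ?normc_ge0 // ell2DE normc_triangle.
Qed.

Lemma ell2_normB f h : ell2_norm (f - h) <= ell2_norm f + ell2_norm h.
Proof. by rewrite -(ell2_normN h) ell2_normD. Qed.

Lemma ell2_norm_sum (I : Type) (r : seq I) (F : I -> ell2 R G) :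
  ell2_norm (\sum_(i <- r) F i) <= \sum_(i <- r) ell2_norm (F i).
Proof.
elim/big_rec2: _ => [|i x y _ le]; first by rewrite ell2_norm0.
by apply: le_trans (ell2_normD _ _) _; rewrite lerD2l.
Qed.

(** This closes the approximation arguments for vectors: an identity that holds on the span holds on
    the algebra up to [e * K], hence exactly. When [K <= 0] the bound at e = 1 is already enough. *)
Lemma ell2_norm_le_eps f (K : R) :
  (forall e : R, 0 < e -> ell2_norm f <= e * K) -> f = 0.
Proof.
move=> h; apply: ell2_norm_eq0; apply/eqP; rewrite eq_le ell2_norm_ge0 andbT.
have [K0|K0] := leP K 0.
  by apply: le_trans (h 1 ltr01) _; rewrite mul1r.
apply/ler_addgt0Pr => e e0; rewrite add0r.
by apply: le_trans (h (e / K) _) _; rewrite ?divr_gt0 // divfK // gt_eqF.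
Qed.

Lemma left_regular_norm x f : ell2_norm (left_regular x f) = ell2_norm f.
Proof.
rewrite /ell2_norm; congr (Num.sqrt (fine _)); rewrite /sqnorm /=.
rewrite [RHS](reindex_esum [set: G] [set: G] (fun g => x^-1 * g)%g) //.
split => //; first by move=> a b _ _; apply: mulgI.
by move=> y _; exists (x * y)%g; rewrite // mulKg.
Qed.

Lemma left_regularE x f g : left_regular x f g = f (x^-1 * g)%g.
Proof. by []. Qed.

Lemma left_regular1 : @left_regular R G 1%g = idfun.
Proof. by apply: funext => f; apply: ell2P => g; rewrite left_regularE invg1 mul1g. Qed.

Lemma left_regularM x y : @left_regular R G (x * y)%g = left_regular x \o left_regular y.
Proof.
by apply: funext => f; apply: ell2P => g; rewrite !left_regularE invgM -mulgA.
Qed.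

Lemma left_regular_linear x : linear (@left_regular R G x).
Proof. by move=> c f h; apply: ell2P. Qed.

Fact indicator_subproof (g : G) :
  (fun x => (x == g)%:R : C) \in square_summable (R := R) (G := G).
Proof.
apply/asboolP; rewrite /sqnorm.
apply: (@le_lt_trans _ _ (\esum_(x in [set g]) 1)%E); last first.
  by rewrite esum_set1 // ltry.
rewrite [leRHS]esum_mkcond; apply: le_esum => x _.
case: ifPn => [|]; first by rewrite inE => /= ->; rewrite eqxx ComplexField.Normc.normc1 expr1n.
by rewrite notin_setE => /= /eqP /negbTE ->; rewrite ComplexField.Normc.normc0 expr0n.
Qed.

Definition delta g : ell2 R G := Ell2 (indicator_subproof g).

Lemma deltaE g x : delta g x = (x == g)%:R. Proof. by []. Qed.

Lemma left_regular_delta x g : left_regular x (delta g) = delta (x * g)%g.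
Proof.
apply: ell2P => y; rewrite left_regularE !deltaE; congr (_%:R).
by rewrite -(inj_eq (@mulgI _ x)) mulVKg.
Qed.

Fact restr_subproof (D : set G) f :
  (fun x => if x \in D then f x else 0 : C) \in square_summable (R := R) (G := G).
Proof.
apply/asboolP; apply: le_lt_trans (sqnorm_lty f).
apply: le_esum => g _; rewrite lee_fin; case: ifP => // _.
by rewrite ComplexField.Normc.normc0 expr0n sqr_ge0.
Qed.

(** The orthogonal projection P_D onto l^2(D). *)
Definition restr (D : set G) f : ell2 R G := Ell2 (restr_subproof D f).

Lemma restrE D f g : restr D f g = if g \in D then f g else 0.
Proof. by []. Qed.

Lemma restr_norm D f : ell2_norm (restr D f) <= ell2_norm f.
Proof.
apply: ell2_norm_le; rewrite ?ell2_norm_ge0 // -sqnormE.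
apply: le_esum => g _; rewrite lee_fin restrE; case: ifP => // _.
by rewrite ComplexField.Normc.normc0 expr0n sqr_ge0.
Qed.

Section DisjointSupports.
Variables (N : nat) (D : 'I_N -> set G).
Hypothesis disjD : forall j k, j != k -> D j `&` D k = set0.

(** Bessel's inequality, checked pointwise: at each g at most one index contributes. *)
Lemma sum_restr_norm f :
  \sum_j ell2_norm (restr (D j) f) ^+ 2 <= ell2_norm f ^+ 2.
Proof.
rewrite -lee_fin -sqnormE -sumEFin.
under eq_bigr do rewrite -sqnormE.
rewrite /sqnorm -esum_sum; last by move=> *; rewrite lee_fin sqr_ge0.
apply: le_esum => g _; rewrite sumEFin lee_fin.
case: (pselect (exists j, g \in D j)) => [[j gj]|nj].
  rewrite (bigD1 j) //= restrE gj big1 ?addr0 // => k kj.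
  rewrite restrE ifF ?ComplexField.Normc.normc0 ?expr0n //; apply/negP => gk.
  by have := disjD kj; apply/eqP/set0P; exists g; split; apply/set_mem.
rewrite big1 ?sqr_ge0 // => k _.
rewrite restrE ifF ?ComplexField.Normc.normc0 ?expr0n //; apply/negP => gk.
by apply: nj; exists k.
Qed.

(** Pythagoras for disjoint supports: N vectors of norm at most b, once projected, have a sum of
    norm at most b sqrt N. *)
Lemma norm_sum_restr (F : 'I_N -> ell2 R G) :
  ell2_norm (\sum_j restr (D j) (F j)) ^+ 2 <= \sum_j ell2_norm (F j) ^+ 2.
Proof.
apply: (@le_trans _ _ (\sum_j ell2_norm (restr (D j) (F j)) ^+ 2)); last first.
  by apply: ler_sum => j _; rewrite ler_pXn2r ?nnegrE ?ell2_norm_ge0 // restr_norm.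
rewrite -lee_fin -sqnormE -sumEFin.
rewrite [leRHS](eq_bigr (fun j => sqnorm (restr (D j) (F j)))); last first.
  by move=> j _; rewrite sqnormE.
rewrite /sqnorm -esum_sum; last by move=> *; rewrite lee_fin sqr_ge0.
apply: le_esum => g _; rewrite sumEFin lee_fin ell2_sumE.
case: (pselect (exists j, g \in D j)) => [[j gj]|nj].
  have z k : k != j -> restr (D k) (F k) g = 0.
    move=> kj; rewrite restrE ifF //; apply/negP => gk.
    by have := disjD kj; apply/eqP/set0P; exists g; split; apply/set_mem.
  have -> : \sum_i restr (D i) (F i) g = restr (D j) (F j) g.
    by rewrite (bigD1 j) //= big1 ?addr0 // => k /z.
  by rewrite [leRHS](bigD1 j) //= lerDl sumr_ge0 // => k _; apply: sqr_ge0.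
have z k : restr (D k) (F k) g = 0.
  by rewrite restrE ifF //; apply/negP => gk; apply: nj; exists k.
rewrite big1; last by move=> k _; apply: z.
by rewrite ComplexField.Normc.normc0 expr0n sumr_ge0 // => k _; apply: sqr_ge0.
Qed.

End DisjointSupports.

End Ell2Space.

(** * Completeness of l^2(G) along geometrically Cauchy sequences *)

Section Completeness.
Variables (R : realType) (G : groupType).

Lemma half_exp_cvg (K : R) : (fun n => K * 2^-1 ^+ n : R) @ \oo --> (0 : R).
Proof.
rewrite -(mulr0 K); apply: cvgMr; apply: cvg_expr.
by rewrite ger0_norm ?invr_ge0 // invf_lt1 // ltr1n.
Qed.

Lemma half_exp_small (K e : R) : 0 < e -> exists n, K * 2^-1 ^+ n < e.
Proof.
move=> e0; have /cvgrPdist_lt /(_ _ e0) [N _ HN] := half_exp_cvg K.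
exists N; apply: le_lt_trans (ler_norm _) _.
by have := HN N (leqnn N); rewrite sub0r normrN.
Qed.

Lemma half_exp_ge0 n : 0 <= 2^-1 ^+ n :> R.
Proof. by rewrite exprn_ge0 // invr_ge0. Qed.

Lemma real_geometric_cvg (u : nat -> R) (c : R) :
  (forall n, `|u n.+1 - u n| <= c * 2^-1 ^+ n) ->
  exists l, forall n, `|l - u n| <= 2 * c * 2^-1 ^+ n.
Proof.
move=> hu.
have half0 := half_exp_ge0.
have c0 : 0 <= c.
  by have := le_trans (normr_ge0 _) (hu 0%N); rewrite expr0 mulr1.
(* The exact partial sum of the geometric series is what makes the induction on k close; the bound
   in n alone is read off afterwards. *)
have tele n k : `|u (n + k)%N - u n| <= 2 * c * (2^-1 ^+ n - 2^-1 ^+ (n + k)).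
  elim: k => [|k IH]; first by rewrite addn0 !subrr normr0 mulr0.
  have -> : u (n + k.+1)%N - u n = (u (n + k).+1 - u (n + k)%N) + (u (n + k)%N - u n).
    by rewrite addnS; ring.
  apply: le_trans (ler_normD _ _) _; apply: le_trans (lerD (hu _) IH) _.
  by rewrite addnS exprS; lra.
have tele' n k : `|u (n + k)%N - u n| <= 2 * c * 2^-1 ^+ n.
  apply: le_trans (tele n k) _; rewrite ler_wpM2l ?mulr_ge0 //.
  by rewrite gerBl.
have cvu : cvgn u.
  apply/cauchy_cvgP/cauchyP => e e0.
  have /cvgrPdist_lt /(_ _ e0) [N _ HN] := half_exp_cvg (2 * c).
  exists (u N); exists N => // k /= Nk.
  have := tele' N (k - N)%N; rewrite subnKC // distrC => /le_lt_trans; apply.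
  by have := HN N (leqnn N); rewrite sub0r normrN ger0_norm // !mulr_ge0.
exists (lim (u @ \oo)) => n.
have : (fun k => `|u (k + n)%N - u n|) @ \oo --> `|lim (u @ \oo) - u n|.
  apply: cvg_norm; apply: cvgB; last exact: cvg_cst.
  by rewrite cvg_shiftn.
move=> cv; rewrite -(cvg_lim _ cv) //; apply: limr_le; first by apply: cvgP cv.
by near=> k; rewrite addnC; apply: tele'.
Unshelve. all: by end_near. Qed.

(** Coordinatewise limits give no control of the norm by themselves. On a finite set A, however, the
    truncation of [l - f n] differs from that of [f (n + m) - f n] by an error that vanishes as m
    grows with A fixed, so it obeys the telescoping bound, uniformly in A. *)
Lemma ell2_complete (f : nat -> ell2 R G) (c : R) :
  (forall n, ell2_norm (f n.+1 - f n) <= c * 2^-1 ^+ n) ->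
  exists l, forall n, ell2_norm (l - f n) <= 2 * c * 2^-1 ^+ n.
Proof.
move=> hf.
have hRe g n : `|complex.Re (f n.+1 g) - complex.Re (f n g)| <= c * 2^-1 ^+ n.
  rewrite -raddfB; apply: le_trans (ReIm_le_normc _).1 _.
  exact: le_trans (ell2_norm_at (f n.+1 - f n) g) (hf n).
have hIm g n : `|complex.Im (f n.+1 g) - complex.Im (f n g)| <= c * 2^-1 ^+ n.
  rewrite -raddfB; apply: le_trans (ReIm_le_normc _).2 _.
  exact: le_trans (ell2_norm_at (f n.+1 - f n) g) (hf n).
have /choice[a ha] := fun g => real_geometric_cvg (hRe g).
have /choice[b hb] := fun g => real_geometric_cvg (hIm g).
have half0 := half_exp_ge0.
have c0 : 0 <= c.
  by have := le_trans (ell2_norm_ge0 _) (hf 0%N); rewrite expr0 mulr1.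
pose l g : R[i] := a g +i* b g.
have hl g n : normc (l g - f n g) <= 4 * c * 2^-1 ^+ n.
  apply: le_trans (normc_le_ReIm _) _; rewrite !raddfB /=.
  by apply: le_trans (lerD (ha g n) (hb g n)) _; lra.
have tele n k : ell2_norm (f (n + k)%N - f n) <= 2 * c * (2^-1 ^+ n - 2^-1 ^+ (n + k)).
  elim: k => [|k IH]; first by rewrite addn0 !subrr ell2_norm0 mulr0.
  have -> : f (n + k.+1)%N - f n = (f (n + k).+1 - f (n + k)%N) + (f (n + k)%N - f n).
    by rewrite addnS addrA subrK.
  apply: le_trans (ell2_normD _ _) _; apply: le_trans (lerD (hf _) IH) _.
  by rewrite addnS exprS; lra.
have fin_bound (A : set G) n : finite_set A ->
    (\sum_(g \in A) (normc (l g - f n g) ^+ 2)%:E <= ((2 * c * 2^-1 ^+ n) ^+ 2)%:E)%E.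
  move=> fA; pose s := finmap.enum_fset (fset_set A).
  have us : uniq s by apply: finmap.fset_uniq.
  pose e : ell2 R G := \sum_(g <- s) (l g - f n g) *: delta R g.
  have sumE (F : G -> R[i]) g : g \in s -> (\sum_(x <- s) F x *: delta R x) g = F g.
    move=> gs; rewrite ell2_sumE (bigD1_seq g) //= big1 ?addr0.
      by rewrite ell2ZE deltaE eqxx mulr1.
    by move=> x xg; rewrite ell2ZE deltaE eq_sym (negbTE xg) mulr0.
  have sumE0 (F : G -> R[i]) g : g \notin s -> (\sum_(x <- s) F x *: delta R x) g = 0.
    move=> gs; rewrite ell2_sumE big_seq big1 // => x xs.
    by rewrite ell2ZE deltaE; case: eqP gs => [->|]; rewrite ?xs ?mulr0.
  have ebnd : ell2_norm e <= 2 * c * 2^-1 ^+ n.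
    apply/ler_addgt0Pr => eps eps0.
    pose K := \sum_(g <- s) 4 * c * ell2_norm (delta R g).
    have [m Km] := half_exp_small K eps0.
    have le_nm : (n <= n + m)%N by apply: leq_addr.
    pose d : ell2 R G := \sum_(g <- s) (l g - f (n + m)%N g) *: delta R g.
    have -> : e = restr [set` s] (f (n + m)%N - f n) + d.
      apply: ell2P => g; rewrite ell2DE restrE /e /d.
      have [gs|gs] := boolP (g \in s).
        by rewrite !sumE // mem_set // ell2BE [RHS]addrC addrA subrK.
      rewrite !sumE0 // (_ : (g \in [set` s]) = false) ?addr0 //.
      by apply/negP => /set_mem /=; apply/negP.
    apply: le_trans (ell2_normD _ _) _; apply: lerD.
      apply: le_trans (restr_norm _ _) _; apply: le_trans (tele n m) _.
      by rewrite ler_wpM2l ?mulr_ge0 // gerBl.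
    apply: le_trans (ltW Km); apply: le_trans (ell2_norm_sum _ _) _.
    rewrite mulr_suml; apply: ler_sum => g _; rewrite ell2_normZ.
    rewrite mulrAC ler_wpM2r ?ell2_norm_ge0 //; apply: le_trans (hl _ _) _.
    rewrite ler_wpM2l ?mulr_ge0 // exprD ler_piMl //.
    by rewrite exprn_ile1 ?invr_ge0 // invf_le1 // ler1n.
  apply: (@le_trans _ _ (sqnorm e)); last first.
    by rewrite sqnormE lee_fin ler_pXn2r ?nnegrE ?ell2_norm_ge0 // !mulr_ge0.
  apply: esum_ge; exists A; first by split.
  rewrite !fsbig_finite //= big_seq [leRHS]big_seq; apply: lee_sum => g gs.
  by rewrite lee_fin sumE.
have sq n : (sqnorm (fun g => (l g - f n g)%R) <= ((2 * c * 2^-1 ^+ n) ^+ 2)%:E)%E.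
  by apply: ge_ereal_sup => _ [A [fA _] <-]; apply: fin_bound.
(* The bound concerns differences only, so the limit enters [ell2] as this difference plus [f 0]. *)
have in2 : (fun g => l g - f 0%N g) \in square_summable (R := R) (G := G).
  by apply/asboolP; apply: le_lt_trans (sq 0%N) _; rewrite ltry.
exists (Ell2 in2 + f 0%N) => n; apply: ell2_norm_le; first by rewrite !mulr_ge0.
apply: le_trans (sq n); apply: le_esum => g _.
by rewrite ell2BE ell2DE /= subrK.
Qed.

End Completeness.

(** * The inner product and Cauchy-Schwarz for its real and imaginary parts *)

Section InnerProduct.
Variables (R : realType) (G : groupType).
Local Notation C := R[i].
Implicit Types (f h k : ell2 R G) (u v : G -> C).

Definition c_summable u :=
  abs_summable (fun g => complex.Re (u g)) /\ abs_summable (fun g => complex.Im (u g)).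

Lemma c_summable_dot f h : c_summable (fun g => f g * (h g)^*).
Proof.
have key (x y : C) : normc (x * y^*) <= normc x ^+ 2 + normc y ^+ 2.
  rewrite ComplexField.Normc.normcM normc_conj.
  rewrite -subr_ge0; set a := normc x; set b := normc y.
  have -> : a ^+ 2 + b ^+ 2 - a * b = (a - b) ^+ 2 + a * b by ring.
  by rewrite addr_ge0 ?sqr_ge0 // mulr_ge0 ?normc_ge0.
have fin : (\esum_(g in [set: G]) (normc (f g) ^+ 2 + normc (h g) ^+ 2)%:E < +oo)%E.
  apply: esumD_lty; try by move=> g; apply: sqr_ge0.
  - exact: (sqnorm_lty f).
  - exact: (sqnorm_lty h).
split; apply: abs_summable_le fin => g.
- exact: le_trans (ReIm_le_normc _).1 (key _ _).
- exact: le_trans (ReIm_le_normc _).2 (key _ _).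
Qed.

Lemma eq_csum u v : u =1 v -> csum u = csum v.
Proof. by move=> /funext ->. Qed.

Lemma csumD u v : c_summable u -> c_summable v ->
  csum (fun g => u g + v g) = csum u + csum v.
Proof.
move=> [ur ui] [vr vi]; rewrite /csum.
rewrite (@eq_rsum _ _ (fun g => complex.Re (u g + v g))
  (fun g => complex.Re (u g) + complex.Re (v g))); last by move=> g; rewrite raddfD.
rewrite (@eq_rsum _ _ (fun g => complex.Im (u g + v g))
  (fun g => complex.Im (u g) + complex.Im (v g))); last by move=> g; rewrite raddfD.
by rewrite !rsumD.
Qed.

Lemma abs_summableZ (c : R) (u : G -> R) : abs_summable u ->
  abs_summable (fun g => c * u g).
Proof.
move=> us; apply: (@abs_summable_le _ _ _ (fun g => `|c| * `|u g|)).
  by move=> g; rewrite normrM.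
by rewrite esumZ // lte_mul_pinfty // lee_fin.
Qed.

Lemma csumZ c u : c_summable u -> csum (fun g => c * u g) = c * csum u.
Proof.
move=> [ur ui]; rewrite /csum; case: c => a b.
rewrite (@eq_rsum _ _ (fun g => complex.Re ((a +i* b) * u g))
  (fun g => a * complex.Re (u g) + (- b) * complex.Im (u g))); last first.
  by move=> g; case: (u g) => x y /=; rewrite mulNr.
rewrite (@eq_rsum _ _ (fun g => complex.Im ((a +i* b) * u g))
  (fun g => a * complex.Im (u g) + b * complex.Re (u g))); last first.
  by move=> g; case: (u g) => x y /=.
rewrite !rsumD ?rsumZ //; try exact: abs_summableZ.
by rewrite mulNr.
Qed.

Lemma dotDl f h k : ell2_dot (f + h) k = ell2_dot f k + ell2_dot h k.
Proof.
rewrite /ell2_dot -csumD; try exact: c_summable_dot.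
by apply: eq_csum => g; rewrite ell2DE mulrDl.
Qed.

Lemma dotZl c f h : ell2_dot (c *: f) h = c * ell2_dot f h.
Proof.
rewrite /ell2_dot -csumZ; last exact: c_summable_dot.
by apply: eq_csum => g; rewrite ell2ZE mulrA.
Qed.

Lemma dotC f h : ell2_dot h f = Num.conj (ell2_dot f h).
Proof.
rewrite conjcE /ell2_dot /csum /=; congr (_ +i* _).
  by apply: eq_rsum => g; case: (f g) (h g) => a b [c d] /=; ring.
rewrite -rsumN.
by apply: eq_rsum => g; case: (f g) (h g) => a b [c d] /=; ring.
Qed.

Lemma dotDr f h k : ell2_dot k (f + h) = ell2_dot k f + ell2_dot k h.
Proof. by rewrite dotC dotDl conjcD -!dotC. Qed.

Lemma dotZr c f h : ell2_dot h (c *: f) = Num.conj c * ell2_dot h f.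
Proof. by rewrite dotC dotZl conjcM -!dotC. Qed.

Lemma dotNl f h : ell2_dot (- f) h = - ell2_dot f h.
Proof. by rewrite -scaleN1r dotZl mulN1r. Qed.

Lemma dotNr f h : ell2_dot h (- f) = - ell2_dot h f.
Proof. by rewrite dotC dotNl conjcN -!dotC. Qed.

Lemma dot0l h : ell2_dot 0 h = 0.
Proof. by rewrite -(scale0r (0 : ell2 R G)) dotZl mul0r. Qed.

Lemma dot_sumr (I : Type) (r : seq I) (F : I -> ell2 R G) f :
  ell2_dot f (\sum_(i <- r) F i) = \sum_(i <- r) ell2_dot f (F i).
Proof.
elim/big_rec2: _ => [|i x y _ <-]; last by rewrite dotDr.
by rewrite dotC dot0l conjC0.
Qed.

Lemma dot_delta f g : ell2_dot f (delta R g) = f g.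
Proof.
have z x : x != g -> f x * (delta R g x)^* = 0.
  by move=> xg; rewrite deltaE conjC_nat (negbTE xg) mulr0.
rewrite /ell2_dot /csum (@rsum_supp1 _ _ _ g); last by move=> x /z ->.
rewrite (@rsum_supp1 _ _ _ g); last by move=> x /z ->.
by rewrite deltaE eqxx conjC_nat mulr1; case: (f g).
Qed.

Lemma dotff f : ell2_dot f f = (ell2_norm f ^+ 2)%:C.
Proof.
rewrite sqr_ell2_norm /ell2_dot /csum; congr (_ +i* _).
  rewrite (@eq_rsum _ _ _ (fun g => normc (f g) ^+ 2)).
    by rewrite rsum_ge0E // => g; apply: sqr_ge0.
  by move=> g; rewrite sqr_normcE; case: (f g) => a b /=; ring.
rewrite (@eq_rsum _ _ _ (fun=> 0)) ?rsum0 //.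
by move=> g; case: (f g) => a b /=; ring.
Qed.

Lemma Re_dot_le f h : `|complex.Re (ell2_dot f h)| <= ell2_norm f * ell2_norm h.
Proof.
have [/ell2_norm_eq0 ->|fn0] := eqVneq (ell2_norm f) 0.
  by rewrite dot0l normr0 mulr_ge0 ?ell2_norm_ge0.
have [/ell2_norm_eq0 ->|hn0] := eqVneq (ell2_norm h) 0.
  by rewrite dotC dot0l conjC0 normr0 mulr_ge0 ?ell2_norm_ge0.
have f0 : 0 < ell2_norm f by rewrite lt_neqAle eq_sym fn0 ell2_norm_ge0.
have h0 : 0 < ell2_norm h by rewrite lt_neqAle eq_sym hn0 ell2_norm_ge0.
(* Since t s = 1/4, t a^2 + s b^2 dominates a b; this choice makes each of the two summed terms half
   the product of the norms. *)
pose t := ell2_norm h / ell2_norm f / 2.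
pose s := ell2_norm f / ell2_norm h / 2.
have t0 : 0 <= t by rewrite !mulr_ge0 ?invr_ge0 ?ell2_norm_ge0.
have s0 : 0 <= s by rewrite !mulr_ge0 ?invr_ge0 ?ell2_norm_ge0.
have ts : t * s = 4^-1 by rewrite /t /s; field; rewrite fn0 hn0.
have key (x y : C) : `|complex.Re (x * y^*)| <= t * normc x ^+ 2 + s * normc y ^+ 2.
  apply: le_trans (ReIm_le_normc _).1 _; rewrite ComplexField.Normc.normcM normc_conj.
  have tp : 0 < t by rewrite !mulr_gt0 ?invr_gt0.
  rewrite -subr_ge0 -(pmulr_rge0 _ tp).
  have -> : t * (t * normc x ^+ 2 + s * normc y ^+ 2 - normc x * normc y) =
    (t * normc x - 2^-1 * normc y) ^+ 2.
    have -> : t * (t * normc x ^+ 2 + s * normc y ^+ 2 - normc x * normc y) =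
     t ^+ 2 * normc x ^+ 2 + (t * s) * normc y ^+ 2 - t * normc x * normc y by ring.
    by rewrite ts; field.
  exact: sqr_ge0.
have F0 : (forall g, 0 <= t * normc (f g) ^+ 2) by move=> g; rewrite mulr_ge0 ?sqr_ge0.
have H0 : (forall g, 0 <= s * normc (h g) ^+ 2) by move=> g; rewrite mulr_ge0 ?sqr_ge0.
have sqf g : 0 <= normc (f g) ^+ 2 by apply: sqr_ge0.
have sqh g : 0 <= normc (h g) ^+ 2 by apply: sqr_ge0.
have Ff : (\esum_(g in [set: G]) (t * normc (f g) ^+ 2)%:E < +oo)%E.
  by rewrite esumZ // lte_mul_pinfty ?lee_fin // (sqnorm_lty f).
have Hf : (\esum_(g in [set: G]) (s * normc (h g) ^+ 2)%:E < +oo)%E.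
  by rewrite esumZ // lte_mul_pinfty ?lee_fin // (sqnorm_lty h).
apply: le_trans (rsum_le (fun g => key (f g) (h g)) (esumD_lty F0 H0 Ff Hf)) _.
rewrite (fine_esumD F0 H0 Ff Hf) !esumZ // -/(sqnorm f) -/(sqnorm h) !sqnormE /=.
rewrite /t /s le_eqVlt; apply/orP; left; apply/eqP.
by field; rewrite fn0 hn0.
Qed.

Lemma Im_dot_le f h : `|complex.Im (ell2_dot f h)| <= ell2_norm f * ell2_norm h.
Proof.
have := Re_dot_le ('i *: f) h; rewrite dotZl ell2_normZ.
rewrite mulrC ReiNIm normrN.
by rewrite /= expr0n /= expr1n add0r sqrtr1 mul1r.
Qed.

Lemma complex_eq0_eps (z : C) (K : R) :
  (forall e : R, 0 < e -> `|complex.Re z| <= e * K /\ `|complex.Im z| <= e * K) -> z = 0.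
Proof.
move=> hz.
have h (a : R) : (forall e, 0 < e -> `|a| <= e * K) -> a = 0.
  move=> ha; apply/eqP; rewrite -normr_eq0 eq_le normr_ge0 andbT.
  have [K0|K0] := leP K 0.
    by apply: le_trans (ha 1 ltr01) _; rewrite mul1r.
  apply/ler_addgt0Pr => e e0; rewrite add0r.
  by apply: le_trans (ha (e / K) _) _; rewrite ?divr_gt0 // divfK // gt_eqF.
case: z hz => a b /= hz.
have -> : a = 0 by apply: h => e /hz [].
by have -> : b = 0 by apply: h => e /hz [].
Qed.

End InnerProduct.

(** * The reduced C*-algebra *)

Section OperatorAlgebra.
Variables (R : realType) (G : groupType).
Local Notation C := R[i].
Local Notation op := (ell2 R G -> ell2 R G).
Local Notation span := (@left_regular_span R G).
Local Notation A := (@reduced_Cstar R G).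
Local Notation lam := (@left_regular R G).
Implicit Types (f h : ell2 R G) (S T : op) (M : R).

Lemma opDE S T f : (S + T) f = S f + T f. Proof. by []. Qed.
Lemma opNE T f : (- T) f = - T f. Proof. by []. Qed.
Lemma opZE c T f : (c *: T) f = c *: T f. Proof. by []. Qed.
Lemma opME S T f : (S \o T) f = S (T f). Proof. by []. Qed.
Definition opE := (opDE, opNE, opZE, opME).

Section Linear.
Variable T : op.
Hypothesis lT : linear T.

Lemma linear_opD f h : T (f + h) = T f + T h.
Proof. by have := lT 1 f h; rewrite !scale1r. Qed.

Lemma linear_op0 : T 0 = 0.
Proof. by apply: (@addrI _ (T 0)); rewrite -linear_opD !addr0. Qed.

Lemma linear_opZ c f : T (c *: f) = c *: T f.
Proof. by have := lT c f 0; rewrite linear_op0 !addr0. Qed.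

Lemma linear_opN f : T (- f) = - T f.
Proof. by rewrite -scaleN1r linear_opZ scaleN1r. Qed.

Lemma linear_opB f h : T (f - h) = T f - T h.
Proof. by rewrite linear_opD linear_opN. Qed.

End Linear.

(** Operator norms enter only through explicit upper bounds; no supremum is ever formed. *)
Definition op_le T M := forall f, ell2_norm (T f) <= M * ell2_norm f.

Lemma op_leW T M M' : M <= M' -> op_le T M -> op_le T M'.
Proof. by move=> MM hT f; apply: le_trans (hT f) _; rewrite ler_wpM2r ?ell2_norm_ge0. Qed.

Lemma op_le_max T M : op_le T M -> op_le T (Num.max 0 M).
Proof. by apply: op_leW; rewrite le_max lexx orbT. Qed.

Lemma op_leD S T M M' : op_le S M -> op_le T M' -> op_le (S + T) (M + M').
Proof.
move=> hS hT f; apply: le_trans (ell2_normD _ _) _.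
by rewrite mulrDl lerD.
Qed.

Lemma op_leZ c T M : op_le T M -> op_le (c *: T) (normc c * M).
Proof.
move=> hT f; rewrite [(c *: T) f]/(c *: T f) ell2_normZ -mulrA.
by rewrite ler_wpM2l ?normc_ge0.
Qed.

Lemma op_leN T M : op_le T M -> op_le (- T) M.
Proof. by move=> hT f; rewrite [(- T) f]/(- T f) ell2_normN. Qed.

Lemma op_leB S T M M' : op_le S M -> op_le T M' -> op_le (S - T) (M + M').
Proof. by move=> hS hT; apply: op_leD => //; apply: op_leN. Qed.

Lemma op_le_comp S T M M' : 0 <= M -> op_le S M -> op_le T M' ->
  op_le (S \o T) (M * M').
Proof.
move=> M0 hS hT f; apply: le_trans (hS _) _.
by rewrite -mulrA ler_wpM2l.
Qed.

Lemma op_le_lam g : op_le (lam g) 1.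
Proof. by move=> f; rewrite left_regular_norm mul1r. Qed.

Lemma op_le0 M : 0 <= M -> op_le 0 M.
Proof. by move=> M0 f; rewrite [X in ell2_norm X](_ : _ = 0) // ell2_norm0 mulr_ge0 ?ell2_norm_ge0. Qed.

Lemma span_ind (P : op -> Prop) : P 0 ->
  (forall c g T, span T -> P T -> P (c *: lam g + T)) -> forall T, span T -> P T.
Proof.
move=> P0 Pstep _ [s ->]; elim: s => [|p s IH]; first by rewrite big_nil.
by rewrite big_cons; apply: Pstep => //; exists s.
Qed.

Lemma span0 : span 0. Proof. by exists [::]; rewrite big_nil. Qed.

Lemma span_cons c g T : span T -> span (c *: lam g + T).
Proof. by case=> s ->; exists ((c, g) :: s); rewrite big_cons. Qed.

Lemma span_lam g : span (lam g).
Proof. by rewrite -[lam g]addr0 -[lam g]scale1r; apply: span_cons span0. Qed.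

Lemma spanD S T : span S -> span T -> span (S + T).
Proof.
move=> sS sT; elim/span_ind: S / sS => [|c g S _ IH]; first by rewrite add0r.
by rewrite -addrA; apply: span_cons.
Qed.

Lemma spanZ c T : span T -> span (c *: T).
Proof.
elim/span_ind => [|d g S _ IH]; first by rewrite scaler0; apply: span0.
by rewrite scalerDr scalerA; apply: span_cons.
Qed.

Lemma span_id : span idfun.
Proof. by rewrite -left_regular1; apply: span_lam. Qed.

Lemma span_linear T : span T -> linear T.
Proof.
elim/span_ind => [|d g S _ IH]; first by move=> c f h; rewrite /= !addr0 scaler0.
move=> c f h; rewrite ![(d *: lam g + S) _]/(d *: lam g _ + S _).
rewrite IH left_regular_linear !scalerDr !scalerA [d * c]mulrC.
by rewrite addrACA.
Qed.

Lemma span_bounded T : span T -> exists2 M, 0 <= M & op_le T M.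
Proof.
elim/span_ind => [|d g S _ [M M0 IH]]; first by exists 0 => //; apply: op_le0.
exists (normc d * 1 + M); first by rewrite addr_ge0 // mulr1 normc_ge0.
by apply: op_leD => //; apply/op_leZ/op_le_lam.
Qed.

Lemma spanM S T : span S -> span T -> span (S \o T).
Proof.
move=> sS sT; elim/span_ind: S / sS => [|c g S _ IH]; first exact: span0.
have -> : (c *: lam g + S) \o T = c *: (lam g \o T) + (S \o T) by [].
apply: spanD => //; apply: spanZ; elim/span_ind: T / sT {IH} => [|d h T _ IH].
  have -> : lam g \o (0 : op) = 0 by apply: funext => f; apply: ell2P.
  exact: span0.
have -> : lam g \o (d *: lam h + T) = d *: lam (g * h)%g + (lam g \o T).
  by rewrite left_regularM; apply: funext => f; apply: ell2P.
exact: span_cons.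
Qed.

Lemma Cstar_linear T : A T -> linear T. Proof. by case=> [[]]. Qed.

Lemma Cstar_bounded T : A T -> exists2 M, 0 <= M & op_le T M.
Proof.
case=> [[_ [M hM]] _]; exists (Num.max 0 M); first by rewrite le_max lexx.
exact: op_le_max.
Qed.

Lemma Cstar_approx T (e : R) : A T -> 0 < e -> exists2 S, span S & op_le (T - S) e.
Proof. by case=> _ /[apply] -[S [sS hS]]; exists S. Qed.

(** Approximants may be taken in the algebra itself instead of the span. The factor K absorbs
    constants, and the restriction [e <= 1] lets products bound the norm of an approximant
    independently of e. *)
Lemma Cstar_intro T M : linear T -> op_le T M ->
  (exists2 K, 0 <= K & forall e, 0 < e -> e <= 1 -> exists2 S, A S & op_le (T - S) (K * e)) -> A T.
Proof.
(* The error e is shared as K d for approximating T by S and d for approximating S in the span,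
   whence the factor [K + 1]. *)
move=> lT hT [K K0 hK]; split; first by split => //; exists M.
move=> e e0; pose d := Num.min 1 (e / (K + 1)).
have K1 : 0 < K + 1 by rewrite ltr_wpDl.
have d0 : 0 < d by rewrite lt_min ltr01 divr_gt0.
have d1 : d <= 1 by rewrite ge_min lexx.
have dK : (K + 1) * d <= e.
  by rewrite mulrC -ler_pdivlMr // ge_min lexx orbT.
have [S AS hS] := hK d d0 d1.
have [S' sS' hS'] := Cstar_approx AS d0.
exists S'; split => // f.
have -> : T f - S' f = (T - S + (S - S')) f.
  by rewrite addrA subrK.
by apply: (op_leW dK); rewrite mulrDl mul1r; apply: op_leD.
Qed.

Lemma Cstar_span T : span T -> A T.
Proof.
move=> sT; have [M M0 hM] := span_bounded sT; split.
  by split; [exact: span_linear | exists M].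
move=> e e0; exists T; split => // f.
by rewrite subrr ell2_norm0 mulr_ge0 ?ell2_norm_ge0 // ltW.
Qed.

Lemma Cstar_lam g : A (lam g). Proof. exact/Cstar_span/span_lam. Qed.

Lemma Cstar_id : A idfun. Proof. exact/Cstar_span/span_id. Qed.

Lemma Cstar0 : A 0. Proof. exact/Cstar_span/span0. Qed.

Lemma Cstar_lin c S T : A S -> A T -> A (c *: S + T).
Proof.
move=> AS AT; have [M M0 hM] := Cstar_bounded AS; have [N N0 hN] := Cstar_bounded AT.
apply: (@Cstar_intro _ (normc c * M + N)).
- move=> d f h; rewrite ![(c *: S + T) _]/(c *: S _ + T _).
  rewrite (Cstar_linear AS) (Cstar_linear AT) !scalerDr !scalerA [d * c]mulrC.
  by rewrite addrACA.
- by apply: op_leD => //; apply: op_leZ.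
- exists (normc c + 1); first by rewrite addr_ge0 ?normc_ge0.
  move=> e e0 _; have [S' sS' hS'] := Cstar_approx AS e0.
  have [T' sT' hT'] := Cstar_approx AT e0.
  exists (c *: S' + T'); first by apply/Cstar_span/spanD => //; apply: spanZ.
  have -> : c *: S + T - (c *: S' + T') = c *: (S - S') + (T - T').
    by rewrite opprD addrACA scalerBr.
  by rewrite mulrDl mul1r; apply: op_leD => //; apply: op_leZ.
Qed.

Lemma CstarZ c T : A T -> A (c *: T).
Proof. by move=> AT; rewrite -[_ *: _]addr0; apply: Cstar_lin => //; apply: Cstar0. Qed.

Lemma CstarD S T : A S -> A T -> A (S + T).
Proof. by move=> AS AT; rewrite -[S]scale1r; apply: Cstar_lin. Qed.

Lemma CstarB S T : A S -> A T -> A (S - T).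
Proof. by move=> AS AT; rewrite addrC -scaleN1r; apply: Cstar_lin. Qed.

Lemma CstarM S T : A S -> A T -> A (S \o T).
Proof.
move=> AS AT; have [M M0 hM] := Cstar_bounded AS; have [N N0 hN] := Cstar_bounded AT.
apply: (@Cstar_intro _ (M * N)).
- by move=> d f h /=; rewrite (Cstar_linear AT) (Cstar_linear AS).
- exact: op_le_comp.
- exists (M + (N + 1)); first by rewrite !addr_ge0.
  move=> e e0 e1; have [S' sS' hS'] := Cstar_approx AS e0.
  have [T' sT' hT'] := Cstar_approx AT e0.
  exists (S' \o T'); first by apply/Cstar_span/spanM.
  have -> : (S \o T) - (S' \o T') = (S \o (T - T')) + ((S - S') \o T').
    apply: funext => f; rewrite !opE.
    by rewrite (linear_opB (Cstar_linear AS)) addrA subrK.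
  rewrite mulrDl; apply: op_leD; first exact: op_le_comp.
  rewrite mulrC; apply: op_le_comp => //; first exact: ltW.
  have -> : T' = T - (T - T') by rewrite opprB addrC subrK.
  by apply: op_leB => //; apply: op_leW hT'.
Qed.

Lemma Cstar_sum (I : Type) (r : seq I) (F : I -> op) :
  (forall i, A (F i)) -> A (\sum_(i <- r) F i).
Proof.
move=> AF; elim: r => [|i r IH]; first by rewrite big_nil; apply: Cstar0.
rewrite big_cons; exact: (CstarD (AF i) IH).
Qed.

Lemma Cstar_functional_eq0 (phi : op -> C) (K : R) :
  (forall S T, A S -> A T -> phi (S - T) = phi S - phi T) ->
  (forall T M, A T -> 0 <= M -> op_le T M -> normc (phi T) <= M * K) ->
  (forall S, span S -> phi S = 0) -> forall T, A T -> phi T = 0.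
Proof.
move=> phiB phi_le phi0 T AT; apply: (@complex_eq0_eps _ _ K) => e e0.
have [S sS hS] := Cstar_approx AT e0.
have AS := Cstar_span sS.
have -> : phi T = phi (T - S) by rewrite phiB // (phi0 S) // subr0.
have := phi_le _ _ (CstarB AT AS) (ltW e0) hS.
by have [] := ReIm_le_normc (phi (T - S)) => h1 h2 h; split; apply: le_trans h.
Qed.

Fact right_translate_subproof (x : G) f :
  (fun g => f (g * x)%g) \in square_summable (R := R) (G := G).
Proof.
apply/asboolP; have := sqnorm_lty f; congr (_ < _)%E.
rewrite /sqnorm (reindex_esum [set: G] [set: G] (fun g => g * x)%g) //.
split => //; first by move=> a b _ _; apply: mulIg.
by move=> y _; exists (y * x^-1)%g; rewrite // mulgVK.
Qed.

Definition right_translate x f : ell2 R G := Ell2 (right_translate_subproof x f).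

Lemma right_translateE x f g : right_translate x f g = f (g * x)%g.
Proof. by []. Qed.

Lemma right_translate_norm x f : ell2_norm (right_translate x f) = ell2_norm f.
Proof.
rewrite /ell2_norm; congr (Num.sqrt (fine _)); rewrite /sqnorm.
rewrite [RHS](reindex_esum [set: G] [set: G] (fun g => g * x)%g) //.
split => //; first by move=> a b _ _; apply: mulIg.
by move=> y _; exists (y * x^-1)%g; rewrite // mulgVK.
Qed.

Lemma right_translate_delta x g : right_translate x (delta R g) = delta R (g * x^-1)%g.
Proof.
apply: ell2P => y; rewrite right_translateE !deltaE.
by rewrite -(inj_eq (@mulIg _ x) y) mulgVK.
Qed.

(** Left and right translations commute by associativity; density carries this from the span to the
    algebra. *)
Lemma Cstar_right_translate T x f : A T ->
  T (right_translate x f) = right_translate x (T f).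
Proof.
move=> AT; apply/eqP; rewrite -subr_eq0; apply/eqP.
apply: (@ell2_norm_le_eps _ _ _ (2 * ell2_norm f)) => e e0.
have [S sS hS] := Cstar_approx AT e0.
have eqS : S (right_translate x f) = right_translate x (S f).
  elim/span_ind: S / sS {hS} => [|c g S _ IH]; first by apply: ell2P.
  rewrite ![(c *: lam g + S) _]/(c *: lam g _ + S _) IH.
  by apply: ell2P => y; rewrite right_translateE !ell2DE !ell2ZE !left_regularE !right_translateE mulgA.
have -> : T (right_translate x f) - right_translate x (T f) =
    (T - S) (right_translate x f) - right_translate x ((T - S) f).
  rewrite [(T - S) (right_translate x f)]/(T _ - S _) eqS.
  by apply: ell2P => y; rewrite !(ell2BE, right_translateE) /=; ring.
apply: le_trans (ell2_normB _ _) _; rewrite right_translate_norm.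
apply: le_trans (lerD (hS _) (hS _)) _; rewrite right_translate_norm.
by rewrite le_eqVlt; apply/orP; left; apply/eqP; ring.
Qed.

End OperatorAlgebra.

(** * Ideals and traces from finite normal subgroups *)

Section FiniteNormalSubgroups.
Variables (R : realType) (G : groupType).
Local Notation C := R[i].
Local Notation op := (ell2 R G -> ell2 R G).
Local Notation span := (@left_regular_span R G).
Local Notation A := (@reduced_Cstar R G).
Local Notation lam := (@left_regular R G).
Implicit Types (f : ell2 R G) (g h : G) (S T : op) (M : R).

Lemma sum_deltaE (s : seq G) g : uniq s ->
  (\sum_(h <- s) delta R h) g = (g \in s)%:R.
Proof.
move=> us; rewrite ell2_sumE; have [gs|gs] := boolP (g \in s).
  rewrite (bigD1_seq g) //= deltaE eqxx big1 ?addr0 // => x xg.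
  by rewrite deltaE eq_sym (negbTE xg).
rewrite big_seq big1 // => x xs; rewrite deltaE.
by case: eqP gs => [->|//]; rewrite xs.
Qed.

Section Subgroup.
Variables (H : set G) (s : seq G).
Hypothesis nH : normal_subgroup H.
Hypothesis Hs : H = [set` s].
Hypothesis us : uniq s.

Lemma subgroup_memP g : reflect (H g) (g \in s).
Proof. by rewrite Hs; apply: (iffP idP). Qed.

Lemma subgroup_mem1 : 1%g \in s.
Proof. exact/subgroup_memP/(normal_subgroup1 nH). Qed.

Lemma subgroup_memMr g h : h \in s -> ((g * h)%g \in s) = (g \in s).
Proof.
move=> /subgroup_memP Hh; apply/subgroup_memP/subgroup_memP => Hg.
  by rewrite -(mulgK h g); apply: normal_subgroupM => //; apply: normal_subgroupV.
exact: normal_subgroupM.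
Qed.

Lemma subgroup_memC g h : ((g * h)%g \in s) = ((h * g)%g \in s).
Proof.
apply/subgroup_memP/subgroup_memP => Hgh.
  rewrite (_ : (h * g = (g * h) ^ h^-1)%g); first exact: normal_subgroupJ.
  by rewrite /conjg invgK !mulgA mulgK.
rewrite (_ : (g * h = (h * g) ^ g^-1)%g); first exact: normal_subgroupJ.
by rewrite /conjg invgK !mulgA mulgK.
Qed.

Lemma subgroup_memV g : (g^-1%g \in s) = (g \in s).
Proof.
apply/subgroup_memP/subgroup_memP => Hg; last exact: normal_subgroupV.
by rewrite -(invgK g); apply: normal_subgroupV.
Qed.

(** With p the mean of the lambda(h) over H, a projection, this is the ideal A p; it is two-sided
    since p is central for normal H. *)
Definition invariant_ideal : set op :=
  [set T | A T /\ forall h, h \in s -> T \o lam h = T].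

Lemma invariant_ideal_closed : closed_ideal invariant_ideal.
Proof.
split.
- by move=> T [].
- by split; [exact: Cstar0 |].
- move=> c S T [AS hS] [AT hT]; split; first exact: Cstar_lin.
  move=> h sh; rewrite -{2}(hS h sh) -{2}(hT h sh).
  by apply: funext => f; rewrite !opE.
- move=> S T AS [AT hT]; split; first exact: CstarM.
  by move=> h sh; rewrite -compA hT.
- move=> T S [AT hT] AS; split; first exact: CstarM.
  move=> h sh; have [M M0 hM] := Cstar_bounded AT.
  apply: funext => f; rewrite !opE.
  apply/eqP; rewrite -subr_eq0; apply/eqP.
  apply: (@ell2_norm_le_eps _ _ _ (2 * M * ell2_norm f)) => e e0.
  have [S' sS' hS'] := Cstar_approx AS e0.
  have eqS : T (S' (lam h f)) = T (S' f).
    elim/span_ind: S' / sS' {hS'} => [|c g S' _ IH] //.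
    rewrite !opE !(linear_opD (Cstar_linear AT)) !(linear_opZ (Cstar_linear AT)) IH.
    congr (_ *: _ + _).
    (* Write lambda(g) lambda(h) as lambda(g h g^-1) lambda(g): the conjugate stays in H, and T
       absorbs it. *)
    have sg : (g * h * g^-1)%g \in s by rewrite subgroup_memC mulKg.
    have := congr1 (fun T' : op => T' (lam g f)) (hT _ sg); rewrite /= => <-.
    congr T; rewrite -!opME -!left_regularM; congr (lam _ f).
    by rewrite mulgVK.
  have -> : T (S (lam h f)) - T (S f) = T ((S - S') (lam h f)) - T ((S - S') f).
    rewrite !opE !(linear_opB (Cstar_linear AT)) eqS.
    by rewrite opprB addrA subrK.
  apply: le_trans (ell2_normB _ _) _.
  have b k : ell2_norm (T ((S - S') k)) <= M * (e * ell2_norm k).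
    by apply: le_trans (hM _) _; rewrite ler_wpM2l.
  apply: le_trans (lerD (b _) (b _)) _; rewrite left_regular_norm.
  by rewrite le_eqVlt; apply/orP; left; apply/eqP; ring.
- move=> T [[lT [M hM]] hT].
  have AT : A T.
    apply: (@Cstar_intro _ _ _ M) => //; exists 1 => // e e0 _.
    by have [S [[AS _] hS]] := hT e e0; exists S => //; rewrite mul1r.
  split => // h sh; apply: funext => f; rewrite opE.
  apply/eqP; rewrite -subr_eq0; apply/eqP.
  apply: (@ell2_norm_le_eps _ _ _ (2 * ell2_norm f)) => e e0.
  have [S [[AS iS] hS]] := hT e e0.
  have eqS : S (lam h f) = S f by rewrite -[in RHS](iS h sh).
  have -> : T (lam h f) - T f = (T (lam h f) - S (lam h f)) - (T f - S f).
    by rewrite eqS opprB addrA subrK.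
  apply: le_trans (ell2_normB _ _) _.
  apply: le_trans (lerD (hS _) (hS _)) _; rewrite left_regular_norm.
  by rewrite le_eqVlt; apply/orP; left; apply/eqP; ring.
Qed.

Lemma invariant_ideal_sum : invariant_ideal (\sum_(h <- s) lam h).
Proof.
split; first by apply: Cstar_sum => h; apply: Cstar_lam.
move=> k sk.
have -> : (\sum_(h <- s) lam h) \o lam k = \sum_(h <- s) lam (h * k)%g.
  elim: (s) => [|x r IH]; first by rewrite !big_nil.
  by rewrite !big_cons -IH left_regularM.
rewrite -(big_map (fun h => h * k)%g predT (fun h => lam h)); apply: perm_big.
apply: uniq_perm => //; first by rewrite map_inj_uniq //; apply: mulIg.
move=> x; apply/mapP/idP => [[y ys ->]|xs]; first by rewrite subgroup_memMr.
exists (x * k^-1)%g; last by rewrite mulgVK.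
by rewrite -(subgroup_memMr _ sk) mulgVK.
Qed.

Lemma invariant_ideal_neq0 : (\sum_(h <- s) lam h) <> 0.
Proof.
move=> h0; have : (\sum_(h <- s) lam h) (delta R 1%g) 1%g = 0 by rewrite h0.
have -> : (\sum_(h <- s) lam h) (delta R 1%g) = \sum_(h <- s) delta R h.
  elim: (s) => [|x r IH]; first by rewrite !big_nil.
  by rewrite !big_cons -IH opE left_regular_delta mulg1.
by rewrite sum_deltaE // subgroup_mem1 => /eqP; rewrite oner_eq0.
Qed.

(** The ideal contains the nonzero sum over H, so it is everything. Then the identity is invariant
    too, that is lambda(h) = 1 for h in H, which evaluation at [delta R 1] permits only for h =
    1. *)
Lemma simple_trivial_subgroup : reduced_Cstar_simple R G -> H = [set 1%g].
Proof.
move=> /(_ _ invariant_ideal_closed) [I0|IA].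
  by case: invariant_ideal_neq0; have := invariant_ideal_sum; rewrite I0.
have [_ hid] : invariant_ideal idfun by rewrite IA; apply: Cstar_id.
apply/seteqP; split => [h /subgroup_memP sh|_ ->]; last exact: normal_subgroup1.
have := congr1 (fun T : op => T (delta R 1%g) h) (hid h sh).
rewrite /= left_regular_delta mulg1 !deltaE eqxx /=.
by case: eqP => // _ /eqP; rewrite oner_eq0.
Qed.

Definition subgroup_trace T : C := T (\sum_(h <- s) delta R h) 1%g.

Lemma subgroup_trace_le T M : op_le T M ->
  normc (subgroup_trace T) <= M * ell2_norm (\sum_(h <- s) delta R h).
Proof. by move=> hT; apply: le_trans (ell2_norm_at _ _) (hT _). Qed.

Lemma subgroup_trace_lam g : subgroup_trace (lam g) = (g \in s)%:R.
Proof. by rewrite /subgroup_trace left_regularE mulg1 sum_deltaE // subgroup_memV. Qed.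

Lemma subgroup_trace_lin c S T :
  subgroup_trace (c *: S + T) = c * subgroup_trace S + subgroup_trace T.
Proof. by []. Qed.

(** On group elements this says that g h lies in H iff h g does. Density is then used once in each
    argument, with the other held fixed. *)
Lemma subgroup_traceC S T : A S -> A T ->
  subgroup_trace (S \o T) = subgroup_trace (T \o S).
Proof.
move=> AS AT; apply/eqP; rewrite -subr_eq0; apply/eqP.
have step (S0 : op) : A S0 ->
    (forall T0, span T0 -> subgroup_trace (S0 \o T0) = subgroup_trace (T0 \o S0)) ->
    forall T0, A T0 -> subgroup_trace (S0 \o T0) - subgroup_trace (T0 \o S0) = 0.
  clear S T AS AT; move=> AS0 h0; have [M M0 hM] := Cstar_bounded AS0.
  apply: (@Cstar_functional_eq0 _ _ _ (2 * M * ell2_norm (\sum_(h <- s) delta R h))).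
  - move=> S1 T1 AS1 AT1; rewrite /subgroup_trace !opE (linear_opB (Cstar_linear AS0)).
    by rewrite !ell2BE; ring.
  - move=> T0 N AT0 N0 hT0; apply: le_trans (normc_triangle _ _) _; rewrite normcN.
    have h1 := subgroup_trace_le (op_le_comp M0 hM hT0).
    have h2 := subgroup_trace_le (op_le_comp N0 hT0 hM).
    by apply: le_trans (lerD h1 h2) _; rewrite le_eqVlt; apply/orP; left; apply/eqP; ring.
  - by move=> T0 sT0; rewrite h0 // subrr.
apply: (step S AS _ T AT) => T0 sT0; apply/esym/eqP; rewrite -subr_eq0; apply/eqP.
apply: (step T0 (Cstar_span sT0) _ S AS).
move=> S0 sS0; elim/span_ind: T0 / sT0 => [|c g T0 sT0 IH].
  by rewrite /subgroup_trace !opE (linear_op0 (span_linear sS0)).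
have -> : (c *: lam g + T0) \o S0 = c *: (lam g \o S0) + (T0 \o S0) by [].
have -> : S0 \o (c *: lam g + T0) = c *: (S0 \o lam g) + (S0 \o T0).
  apply: funext => f; rewrite !opE (linear_opD (span_linear sS0)).
  by rewrite (linear_opZ (span_linear sS0)).
rewrite !subgroup_trace_lin IH; congr (_ * _ + _).
elim/span_ind: S0 / sS0 {IH} => [|d k S0 sS0 IH].
  by rewrite /subgroup_trace !opE (linear_op0 (@left_regular_linear _ _ _)).
have -> : (d *: lam k + S0) \o lam g = d *: (lam k \o lam g) + (S0 \o lam g) by [].
have -> : lam g \o (d *: lam k + S0) = d *: (lam g \o lam k) + (lam g \o S0).
  apply: funext => f; rewrite !opE (linear_opD (@left_regular_linear _ _ _)).
  by rewrite (linear_opZ (@left_regular_linear _ _ _)).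
rewrite !subgroup_trace_lin IH -!left_regularM !subgroup_trace_lam.
by rewrite subgroup_memC.
Qed.

(** The indicator of H is invariant under right translation by H, hence so is its image under T,
    which is therefore constant on H. *)
Lemma subgroup_trace_translate T h : A T -> h \in s ->
  T (\sum_(h <- s) delta R h) h = subgroup_trace T.
Proof.
move=> AT sh; rewrite /subgroup_trace -[in RHS](mulgV h).
set xi := \sum_(h <- s) _.
have {2}-> : xi = right_translate h xi.
  by apply: ell2P => g; rewrite right_translateE !sum_deltaE // subgroup_memMr.
by rewrite Cstar_right_translate // right_translateE mulgVK.
Qed.

Lemma subgroup_trace_normalized : normalized_trace subgroup_trace.
Proof.
split.
- by move=> c S T _ _; apply: subgroup_trace_lin.
- move=> S T AT AS adj; set xi := \sum_(h <- s) delta R h.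
  have AST : A (S \o T) by apply: CstarM.
  (* Positivity: adding up the constant value over H gives |H| times the trace, and the left side is
     the squared norm of T xi. *)
  have e : ell2_dot ((S \o T) xi) xi = (size s)%:R * subgroup_trace (S \o T).
    rewrite /xi dot_sumr big_seq.
    rewrite (eq_bigr (fun=> subgroup_trace (S \o T))); last first.
      by move=> h sh; rewrite dot_delta subgroup_trace_translate.
    by rewrite -big_seq big_const_seq count_predT iter_addr_0 mulr_natl.
  have s0 : 0 < (size s)%:R :> C.
    by rewrite ltr0n; case: (s) subgroup_mem1.
  rewrite -(pmulr_rge0 _ s0) -e dotC opE -adj dotff conjcE /= oppr0.
  by rewrite lecE /= eqxx sqr_ge0.
- by rewrite /subgroup_trace sum_deltaE // subgroup_mem1.
- exact: subgroup_traceC.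
Qed.

End Subgroup.

Lemma normal_subgroup_trivial : @normal_subgroup G [set 1%g].
Proof.
split=> //=.
- by move=> x y -> ->; rewrite mulg1.
- by move=> x ->; rewrite invg1.
- by move=> x y ->; rewrite conj1g.
Qed.

Lemma seq1_set1 : [set 1%g] = [set` [:: 1%g : G]].
Proof. by apply/seteqP; split => x /=; rewrite inE => /eqP. Qed.

Definition canonical_trace := subgroup_trace [:: 1%g].

Lemma canonical_trace_normalized : normalized_trace canonical_trace.
Proof. exact: subgroup_trace_normalized normal_subgroup_trivial seq1_set1 _. Qed.

Lemma unique_trace_trivial_subgroup (H : set G) (s : seq G) :
  normal_subgroup H -> H = [set` s] -> uniq s ->
  reduced_Cstar_unique_trace R G -> H = [set 1%g].
Proof.
move=> nH Hs us [tau [_ utau]].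
apply/seteqP; split => [h /(subgroup_memP Hs) sh|_ ->]; last exact: normal_subgroup1.
have := utau _ (subgroup_trace_normalized nH Hs us) _ (Cstar_lam R h).
rewrite -(utau _ canonical_trace_normalized _ (Cstar_lam R h)).
rewrite (subgroup_trace_lam nH Hs us) sh.
rewrite /canonical_trace (subgroup_trace_lam normal_subgroup_trivial seq1_set1) // inE.
by case: eqP => // _ /eqP; rewrite oner_eq0.
Qed.

End FiniteNormalSubgroups.

(** * Adjoints, square roots and boundedness of traces *)

Section Adjoints.
Variables (R : realType) (G : groupType).
Local Notation C := R[i].
Local Notation op := (ell2 R G -> ell2 R G).
Local Notation span := (@left_regular_span R G).
Local Notation A := (@reduced_Cstar R G).
Local Notation lam := (@left_regular R G).
Implicit Types (f h : ell2 R G) (S T x : op) (M : R).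

Lemma adjoint_sym T S : adjoint T S -> adjoint S T.
Proof. by move=> TS f h; rewrite dotC -TS -dotC. Qed.

Lemma adjoint_lin c T S T' S' : adjoint T S -> adjoint T' S' ->
  adjoint (c *: T + T') (Num.conj c *: S + S').
Proof.
by move=> TS TS' f h; rewrite !opE dotDl dotDr dotZl dotZr conjCK TS TS'.
Qed.

Lemma adjoint_real_lin (r : R) T S T' S' : adjoint T S -> adjoint T' S' ->
  adjoint (r%:C *: T + T') (r%:C *: S + S').
Proof.
move=> TS TS'; have := adjoint_lin r%:C TS TS'.
by rewrite (_ : Num.conj r%:C = r%:C) // conjcE /= oppr0.
Qed.

Lemma adjoint_comp T S T' S' : adjoint T S -> adjoint T' S' ->
  adjoint (T \o T') (S' \o S).
Proof. by move=> TS TS' f h; rewrite !opE TS TS'. Qed.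

Lemma adjoint_id : adjoint (idfun : op) idfun. Proof. by []. Qed.

Lemma adjoint0 : adjoint (0 : op) 0.
Proof. by move=> f h; rewrite dot0l dotC dot0l conjC0. Qed.

Lemma rsum_translate (u : G -> R) g : rsum (fun y => u (g * y)%g) = rsum u.
Proof.
have bij : set_bij [set: G] [set: G] (fun y => g * y)%g.
  split => //; first by move=> a b _ _; apply: mulgI.
  by move=> y _; exists (g^-1 * y)%g; rewrite // mulVKg.
rewrite /rsum; congr (fine _ - fine _).
  by rewrite [RHS](reindex_esum _ _ _ _ bij).
by rewrite [RHS](reindex_esum _ _ _ _ bij).
Qed.

Lemma adjoint_lam g : adjoint (lam g) (lam g^-1%g).
Proof.
move=> f h; rewrite /ell2_dot /csum.
rewrite -(rsum_translate _ g) -[X in _ +i* X](rsum_translate _ g).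
by congr (_ +i* _); apply: eq_rsum => y; rewrite !left_regularE mulKg invgK.
Qed.

Lemma adjoint_op_le T S M : adjoint T S -> 0 <= M -> op_le T M -> op_le S M.
Proof.
move=> TS M0 hT f.
have [->|n0] := eqVneq (ell2_norm (S f)) 0; first by rewrite mulr_ge0 ?ell2_norm_ge0.
have p0 : 0 < ell2_norm (S f) by rewrite lt_neqAle eq_sym n0 ell2_norm_ge0.
rewrite -(ler_pM2r p0) -expr2.
have -> : ell2_norm (S f) ^+ 2 = complex.Re (ell2_dot (T (S f)) f) by rewrite TS dotff.
apply: le_trans (ler_norm _) _; apply: le_trans (Re_dot_le _ _) _.
by rewrite mulrAC ler_wpM2r ?ell2_norm_ge0.
Qed.

Lemma span_adjoint T : span T -> exists2 S, span S & adjoint T S.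
Proof.
elim/span_ind => [|c g S _ [S' sS' adj]].
  by exists 0; [exact: span0 | exact: adjoint0].
exists (Num.conj c *: lam g^-1%g + S'); first exact: span_cons.
by apply: adjoint_lin => //; apply: adjoint_lam.
Qed.

Lemma adjoint_lim T S (K : R) :
  (forall e, 0 < e -> exists T' S', [/\ adjoint T' S', op_le (T - T') (K * e) &
     op_le (S - S') (K * e)]) -> adjoint T S.
Proof.
move=> hlim f h; apply/eqP; rewrite -subr_eq0; apply/eqP.
apply: (@complex_eq0_eps _ _ (2 * K * ell2_norm f * ell2_norm h)) => e e0.
have [T' [S' [adj hT hS]]] := hlim e e0.
have -> : ell2_dot (T f) h - ell2_dot f (S h) =
    ell2_dot ((T - T') f) h - ell2_dot f ((S - S') h).
  by rewrite !opE dotDl dotDr dotNl dotNr adj opprB addrA subrK.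
have bnd : ell2_norm ((T - T') f) * ell2_norm h + ell2_norm f * ell2_norm ((S - S') h)
    <= e * (2 * K * ell2_norm f * ell2_norm h).
  have h1 := ler_wpM2r (ell2_norm_ge0 h) (hT f).
  have h2 := ler_wpM2l (ell2_norm_ge0 f) (hS h).
  apply: le_trans (lerD h1 h2) _.
  by rewrite le_eqVlt; apply/orP; left; apply/eqP; ring.
have ReB (z z' : C) : `|complex.Re (z - z')| <= `|complex.Re z| + `|complex.Re z'|.
  by case: z z' => a b [a' b']; apply: ler_normB.
have ImB (z z' : C) : `|complex.Im (z - z')| <= `|complex.Im z| + `|complex.Im z'|.
  by case: z z' => a b [a' b']; apply: ler_normB.
split; apply: le_trans bnd.
  exact: le_trans (ReB _ _) (lerD (Re_dot_le _ _) (Re_dot_le _ _)).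
exact: le_trans (ImB _ _) (lerD (Im_dot_le _ _) (Im_dot_le _ _)).
Qed.

(** The limit is chosen vector by vector; the rate is uniform in f, so it is a norm limit, and
    linearity is recovered from the approximants. *)
Lemma Cstar_complete (T : nat -> op) (c : R) : (forall n, A (T n)) ->
  (forall n, op_le (T n.+1 - T n) (c * 2^-1 ^+ n)) ->
  exists2 L, A L & forall n, op_le (L - T n) (2 * c * 2^-1 ^+ n).
Proof.
move=> AT hT.
have hf f n : ell2_norm (T n.+1 f - T n f) <= (c * ell2_norm f) * 2^-1 ^+ n.
  by rewrite mulrAC; apply: hT.
have /choice[L hL] := fun f => ell2_complete (hf f).
have hL' n : op_le (L - T n) (2 * c * 2^-1 ^+ n).
  move=> f; apply: le_trans (hL f n) _.
  by rewrite le_eqVlt; apply/orP; left; apply/eqP; ring.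
have small (e : R) : 0 < e -> exists n, op_le (L - T n) e.
  move=> e0; have [n hn] := half_exp_small (2 * c) e0.
  by exists n; apply: op_leW (hL' n); apply: ltW.
exists L => //; have [M M0 hM] := Cstar_bounded (AT 0%N).
apply: (@Cstar_intro _ _ _ (2 * c * 2^-1 ^+ 0 + M)).
- move=> d f h; apply/eqP; rewrite -subr_eq0; apply/eqP.
  apply: (@ell2_norm_le_eps _ _ _
    (ell2_norm (d *: f + h) + normc d * ell2_norm f + ell2_norm h)) => e e0.
  have [n hn] := small e e0; have lT := Cstar_linear (AT n).
  have -> : L (d *: f + h) - (d *: L f + L h) =
     (L - T n) (d *: f + h) - d *: (L - T n) f - (L - T n) h.
    rewrite !opE lT; apply: ell2P => g.
    by rewrite !(ell2DE, ell2NE, ell2ZE); ring.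
  apply: le_trans (ell2_normB _ _) _; rewrite !mulrDr; apply: lerD (hn _).
  apply: le_trans (ell2_normB _ _) _; apply: lerD (hn _) _.
  by rewrite ell2_normZ mulrCA ler_wpM2l ?normc_ge0.
- have -> : L = (L - T 0%N) + T 0%N by rewrite subrK.
  exact: op_leD.
- exists 1 => // e e0 _; have [n hn] := small e e0.
  by exists (T n) => //; rewrite mul1r.
Qed.

Lemma half_exp_gt0 n : 0 < 2^-1 ^+ n :> R.
Proof. by rewrite exprn_gt0 // invr_gt0. Qed.

(** Take span elements V n converging to T at a geometric rate. Passing to adjoints does not
    increase norms, so the adjoints W n are geometrically Cauchy too, and their limit is the adjoint
    of T. *)
Lemma Cstar_adjoint T : A T -> exists2 S, A S & adjoint T S.
Proof.
move=> AT.
have /choice[V hV] : forall n, exists V, span V /\ op_le (T - V) (2^-1 ^+ n).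
  by move=> n; have [V sV hV] := Cstar_approx AT (half_exp_gt0 n); exists V.
have /choice[W hW] : forall n, exists W, span W /\ adjoint (V n) W.
  by move=> n; have [W sW hW] := span_adjoint (hV n).1; exists W.
have [L AL hL] : exists2 L, A L & forall n, op_le (L - W n) (2 * 2 * 2^-1 ^+ n).
  apply: Cstar_complete => [n|n]; first exact: Cstar_span (hW n).1.
  apply: (@adjoint_op_le (V n.+1 - V n)).
  - have := adjoint_lin (-1) (hW n).2 (hW n.+1).2.
    by rewrite conjcN conjC1 !scaleN1r ![- _ + _]addrC.
  - by rewrite mulr_ge0 // half_exp_ge0.
  have -> : V n.+1 - V n = (T - V n) - (T - V n.+1).
    by rewrite opprB [in RHS]addrC addrA subrK.
  apply: op_leW (op_leB (hV n).2 (hV n.+1).2).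
  by rewrite exprS; have := half_exp_ge0 R n; lra.
exists L => //; apply: (@adjoint_lim _ _ 4) => e e0.
have [n hn] := half_exp_small 1 e0; rewrite mul1r in hn.
exists (V n), (W n); split; first exact: (hW n).2.
  by apply: op_leW (hV n).2; have := half_exp_ge0 R n; lra.
by apply: op_leW (hL n); lra.
Qed.

(* The iteration w |-> (x + w^2) / 2 is a contraction near 0; its fixed point w
   satisfies (1 - w)^2 = 1 - x. *)
Fixpoint sqrt_iter x n : op :=
  if n is n'.+1 then 2^-1%:C *: x + 2^-1%:C *: (sqrt_iter x n' \o sqrt_iter x n') else 0.

Lemma normc_half : normc (2^-1%:C : C) = 2^-1.
Proof. by rewrite normcC ger0_norm // invr_ge0. Qed.

Lemma sqr_sub_op S T : linear S ->
  (S \o S) - (T \o T) = (S \o (S - T)) + ((S - T) \o T).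
Proof.
move=> lS; apply: funext => f; rewrite !opE (linear_opB lS).
by rewrite addrA subrK.
Qed.

Lemma Cstar_sqrt x : A x -> adjoint x x -> op_le x 2^-1 ->
  exists y, [/\ A y, adjoint y y & y \o y = idfun - x].
Proof.
move=> Ax sx hx.
have [w [w0 wS]] : exists w : nat -> op, w 0%N = 0 /\
    forall n, w n.+1 = 2^-1%:C *: x + 2^-1%:C *: (w n \o w n).
  by exists (sqrt_iter x).
have Aw n : A (w n).
  elim: n => [|n IH]; first by rewrite w0; apply: Cstar0.
  by rewrite wS; exact: (Cstar_lin _ Ax (CstarZ _ (CstarM IH IH))).
have sw n : adjoint (w n) (w n).
  elim: n => [|n IH]; first by rewrite w0; apply: adjoint0.
  rewrite wS; apply: adjoint_real_lin => //.
  have := adjoint_real_lin 2^-1 (adjoint_comp IH IH) adjoint0.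
  by rewrite !addr0.
(* The ball of radius 1/2 is stable, as 1/2 * 1/2 + 1/2 * 1/4 <= 1/2. *)
have bw n : op_le (w n) 2^-1.
  elim: n => [|n IH]; first by rewrite w0; apply: op_le0; rewrite invr_ge0.
  rewrite wS; apply: (@op_leW _ _ _ (2^-1 * 2^-1 + 2^-1 * (2^-1 * 2^-1))); first by lra.
  apply: op_leD; first by have := op_leZ 2^-1%:C hx; rewrite normc_half.
  have h2 : 0 <= 2^-1 :> R by rewrite invr_ge0.
  by have := op_leZ 2^-1%:C (op_le_comp h2 IH IH); rewrite normc_half.
have half0 : 0 <= 2^-1 :> R by rewrite invr_ge0.
(* On that ball squaring is 1-Lipschitz, by S^2 - T^2 = S (S - T) + (S - T) T, so the outer factor
   1/2 halves each increment. *)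
have dw n : op_le (w n.+1 - w n) (2^-1 * 2^-1 ^+ n).
  elim: n => [|n IH].
    by rewrite w0 subr0 expr0 mulr1; apply: bw.
  have -> : w n.+2 - w n.+1 = 2^-1%:C *: ((w n.+1 \o w n.+1) - (w n \o w n)).
    transitivity ((2^-1%:C *: x + 2^-1%:C *: (w n.+1 \o w n.+1)) -
                  (2^-1%:C *: x + 2^-1%:C *: (w n \o w n))); first by rewrite -!wS.
    by rewrite opprD addrACA subrr add0r scalerBr.
  rewrite (sqr_sub_op _ (Cstar_linear (Aw n.+1))).
  have d0 : 0 <= 2^-1 * 2^-1 ^+ n :> R by rewrite mulr_ge0 ?half_exp_ge0.
  have h1 := op_le_comp half0 (bw n.+1) IH.
  have h2 := op_le_comp d0 IH (bw n).
  apply: op_leW (op_leZ 2^-1%:C (op_leD h1 h2)).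
  by rewrite normc_half exprS; lra.
have [L AL hL] := Cstar_complete Aw dw.
have hL' n : op_le (L - w n) (2^-1 ^+ n).
  by apply: op_leW (hL n); rewrite mulfV ?mul1r.
have sL : adjoint L L.
  apply: (@adjoint_lim _ _ 1) => e e0.
  have [n hn] := half_exp_small 1 e0; rewrite mul1r in hn.
  by exists (w n), (w n); split => //; rewrite mul1r; apply: op_leW (hL' n); apply: ltW.
have [M M0 hM] := Cstar_bounded AL.
have fix_L : L = 2^-1%:C *: x + 2^-1%:C *: (L \o L).
  apply/eqP; rewrite -subr_eq0; apply/eqP/funext => f.
  apply: (@ell2_norm_le_eps _ _ _ ((1 + (M + 1)) * ell2_norm f)) => e e0.
  have [n hn] := half_exp_small 1 e0; rewrite mul1r in hn.
  have -> : L - (2^-1%:C *: x + 2^-1%:C *: (L \o L)) =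
      (L - w n.+1) - 2^-1%:C *: ((L \o (L - w n)) + ((L - w n) \o w n)).
    rewrite -(sqr_sub_op _ (Cstar_linear AL)).
    rewrite wS scalerBr opprB; apply: funext => g; rewrite !opE; apply: ell2P => k.
    by rewrite !(ell2DE, ell2NE, ell2ZE); ring.
  rewrite mulrA; move: f; apply: op_leW (op_leB (hL' _) (op_leZ _ (op_leD
     (op_le_comp M0 hM (hL' n)) (op_le_comp (half_exp_ge0 R n) (hL' n) (bw n))))).
  rewrite normc_half exprS; have := half_exp_ge0 R n.
  set q := 2^-1 ^+ n in hn * => q0.
  have : M * q <= M * e by rewrite ler_wpM2l // ltW.
  have : 0 <= M * q by rewrite mulr_ge0.
  by lra.
exists (idfun - L); split.
- exact: (CstarB (Cstar_id R G) AL).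
- have := adjoint_lin (-1) sL adjoint_id.
  by rewrite conjcN conjC1 !scaleN1r addrC.
apply: funext => f; rewrite !opE /= (linear_opB (Cstar_linear AL)).
have := congr1 (fun T : op => 2 *: T f) fix_L; rewrite !opE => e.
have e2 : (2 : C) * 2^-1%:C = 1.
  by rewrite -[2 : C]/((2%:R : C)) -(rmorph_nat (real_complex R)) -rmorphM mulfV // pnatr_eq0.
rewrite scalerDr !scalerA e2 !scale1r in e.
have -> : x f = 2 *: L f - L (L f) by rewrite e addrK.
by apply: ell2P => g; rewrite !(ell2DE, ell2NE, ell2ZE); ring.
Qed.

(** * Automatic continuity of positive traces *)

Section PositiveTrace.
Variable tau : op -> C.
Hypothesis tr : normalized_trace tau.

Lemma trace0 : tau 0 = 0.
Proof.
have := trace_linear tr 1 (Cstar0 R G) (Cstar0 R G).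
by rewrite scale1r addr0 mul1r => /eqP; rewrite -subr_eq subrr => /eqP.
Qed.

Lemma traceD S T : A S -> A T -> tau (S + T) = tau S + tau T.
Proof. by move=> AS AT; have := trace_linear tr 1 AS AT; rewrite scale1r mul1r. Qed.

Lemma traceZ c T : A T -> tau (c *: T) = c * tau T.
Proof.
by move=> AT; have := trace_linear tr c AT (Cstar0 R G); rewrite addr0 trace0 addr0.
Qed.

Lemma traceB S T : A S -> A T -> tau (S - T) = tau S - tau T.
Proof.
by move=> AS AT; rewrite addrC -scaleN1r (trace_linear tr) // mulN1r addrC.
Qed.

(** The order of [R[i]] relates only numbers with equal imaginary parts, so the conclusion also says
    that [tau x] is real. *)
Lemma trace_selfadjoint_half x : A x -> adjoint x x -> op_le x 2^-1 -> tau x <= 1.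
Proof.
move=> Ax sx hx; have [y [Ay sy e]] := Cstar_sqrt Ax sx hx.
have := trace_pos tr Ay Ay sy; rewrite e (traceB (Cstar_id R G) Ax).
by rewrite (trace1 tr) subr_ge0.
Qed.

Lemma trace_selfadjoint_le x M : A x -> adjoint x x -> 0 < M -> op_le x M ->
  normc (tau x) <= 2 * M.
Proof.
move=> Ax sx M0 hx; pose c : R := (2 * M)^-1.
have M2 : 0 < 2 * M by rewrite mulr_gt0.
have cM : c * M = 2^-1 by rewrite /c invfM mulfVK // gt_eqF.
(* Scaling by c brings the norm down to 1/2; the two signs of d give the two-sided bound on the real
   part. *)
have sel (d : R) : `|d| = c -> d * complex.Re (tau x) <= 1 /\ complex.Im (tau x) = 0.
  move=> dc; have : tau (d%:C *: x) <= 1.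
    apply: trace_selfadjoint_half; first exact: CstarZ.
      by have := adjoint_real_lin d sx adjoint0; rewrite !addr0.
    by rewrite -cM -dc -normcC; apply: op_leZ.
  rewrite traceZ // lecE; case: (tau x) => a b /=.
  rewrite !mul0r subr0 addr0 => /andP[/eqP h1 h2]; split => //.
  move/esym/eqP: h1; rewrite mulf_eq0 -normr_eq0 dc invr_eq0 (gt_eqF M2) => /eqP.
  by [].
have c0 : 0 <= c by rewrite invr_ge0 ltW.
have [h1 im0] := sel c (ger0_norm c0).
have [h2 _] : - c * complex.Re (tau x) <= 1 /\ complex.Im (tau x) = 0.
  by apply: sel; rewrite normrN ger0_norm.
apply: le_trans (normc_le_ReIm _) _; rewrite im0 normr0 addr0.
have c1 : c * (2 * M) = 1 by rewrite mulVf // gt_eqF.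
have cp : 0 < c by rewrite invr_gt0.
rewrite -(ler_pM2l cp) c1 -{1}(ger0_norm c0) -normrM ler_norml h1 andbT.
by rewrite lerNl -mulNr.
Qed.

(** Cartesian decomposition: 2 T = a - i b with a = T + S and b = i (T - S) self-adjoint of norm at
    most 2 M. Each contributes at most 4 M to |2 tau(T)|. *)
Lemma trace_le T M : A T -> 0 < M -> op_le T M -> normc (tau T) <= 4 * M.
Proof.
move=> AT M0 hT; have [S AS adj] := Cstar_adjoint AT.
have hS := adjoint_op_le adj (ltW M0) hT.
have adj' := adjoint_sym adj.
pose a := T + S; pose b := 'i *: (T - S).
have Aa : A a by apply: CstarD.
have Ab : A b by apply/CstarZ/CstarB.
have sa : adjoint a a.
  by have := adjoint_lin 1 adj adj'; rewrite conjC1 !scale1r [S + T]addrC.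
have sb : adjoint b b.
  have e : - 'i *: S + 'i *: T = b by rewrite /b scalerBr addrC scaleNr.
  have := adjoint_lin 'i adj (adjoint_lin (- 'i) adj' adjoint0).
  rewrite !addr0 conjcN (_ : Num.conj ('i : C) = - 'i); last first.
    by rewrite conjcE; apply/eqP; rewrite eq_complex /= oppr0 !eqxx.
  by rewrite opprK e addrC e.
have M2 : 0 < M + M by rewrite addr_gt0.
have ha := trace_selfadjoint_le Aa sa M2 (op_leD hT hS).
have nb : op_le b (M + M).
  have := op_leZ 'i (op_leB hT hS).
  by rewrite {1}/ComplexField.Normc.normc /= expr0n expr1n add0r sqrtr1 mul1r.
have hb := trace_selfadjoint_le Ab sb M2 nb.
have e : 2 * tau T = tau a - 'i * tau b.
  rewrite /a /b (traceZ _ (CstarB AT AS)) (traceD AT AS) (traceB AT AS) mulrA.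
  by rewrite -expr2 sqr_i; ring.
have : normc (2 * tau T) <= 2 * (M + M) + 2 * (M + M).
  rewrite e; apply: le_trans (normc_triangle _ _) _; rewrite normcN.
  rewrite (ComplexField.Normc.normcM 'i).
  rewrite [X in X * _](_ : _ = 1) ?mul1r; first exact: lerD.
  by rewrite /= expr0n expr1n add0r sqrtr1.
rewrite ComplexField.Normc.normcM (_ : normc 2 = 2); last first.
  by rewrite -(rmorph_nat (real_complex R)) normcC ger0_norm.
by lra.
Qed.

End PositiveTrace.

End Adjoints.

(** * Powers averaging *)

Section Averaging.
Variables (R : realType) (G : groupType).
Local Notation C := R[i].
Local Notation op := (ell2 R G -> ell2 R G).
Local Notation span := (@left_regular_span R G).
Local Notation A := (@reduced_Cstar R G).
Local Notation lam := (@left_regular R G).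
Local Notation tau0 := (@canonical_trace R G).
Implicit Types (f h u : ell2 R G) (S T : op) (M : R).

(** Cauchy-Schwarz against the constant 1. A square number N = m * m of terms makes sqrt N the
    integer m. *)
Lemma sum_le_of_sqr (m : nat) (a : 'I_(m * m) -> R) (b : R) : (0 < m)%N -> 0 <= b ->
  \sum_j a j ^+ 2 <= b ^+ 2 -> \sum_j a j <= m%:R * b.
Proof.
move=> m0 b0 hab.
have [b_eq0|bn0] := eqVneq b 0.
  rewrite b_eq0 mulr0 big1 // => j _; apply/eqP; rewrite -sqrf_eq0 eq_le sqr_ge0 andbT.
  rewrite b_eq0 expr0n in hab; apply: le_trans hab.
  by rewrite (bigD1 j) //= lerDl sumr_ge0 // => k _; apply: sqr_ge0.
have bp : 0 < b by rewrite lt_neqAle eq_sym bn0.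
have mp : 0 < m%:R :> R by rewrite ltr0n.
(* t is the common value of the a j in the case of equality, hence the right weight for AM-GM. *)
pose t := b / m%:R; have tp : 0 < t by rewrite divr_gt0.
have amgm j : a j <= 2^-1 * t + 2^-1 / t * a j ^+ 2.
  rewrite -subr_ge0.
  have -> : 2^-1 * t + 2^-1 / t * a j ^+ 2 - a j = 2^-1 / t * (t - a j) ^+ 2.
    by field; rewrite gt_eqF.
  by rewrite mulr_ge0 ?sqr_ge0 // divr_ge0 ?invr_ge0 // ltW.
apply: (@le_trans _ _ (\sum_(j < m * m) (2^-1 * t + 2^-1 / t * a j ^+ 2))).
  by apply: ler_sum.
rewrite big_split /= sumr_const card_ord -mulr_sumr -[X in X + _]mulr_natl natrM.
apply: (@le_trans _ _ (m%:R * m%:R * (2^-1 * t) + 2^-1 / t * b ^+ 2)).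
  by rewrite lerD2l ler_wpM2l // divr_ge0 ?invr_ge0 // ltW.
rewrite le_eqVlt; apply/orP; left; apply/eqP; rewrite /t.
by field; rewrite (gt_eqF mp) bn0.
Qed.

Definition average (N : nat) (gamma : 'I_N -> G) T : op :=
  (N%:R)^-1 *: \sum_j (lam (gamma j) \o T \o lam (gamma j)^-1%g).

Lemma op_sumE (I : Type) (r : seq I) (F : I -> op) f :
  (\sum_(i <- r) F i) f = \sum_(i <- r) F i f.
Proof. by elim/big_rec2: _ => // i x y _ <-. Qed.

Lemma averageE N (gamma : 'I_N -> G) T f : average gamma T f =
  (N%:R)^-1 *: \sum_j lam (gamma j) (T (lam (gamma j)^-1%g f)).
Proof. by rewrite /average opZE op_sumE. Qed.

Lemma averageD N (gamma : 'I_N -> G) S T :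
  average gamma (S + T) = average gamma S + average gamma T.
Proof.
apply: funext => f; rewrite opDE !averageE -scalerDr -big_split; congr (_ *: _).
by apply: eq_bigr => j _; rewrite opDE (linear_opD (@left_regular_linear _ _ _)).
Qed.

Lemma normc_natV N : normc ((N%:R : C)^-1) = (N%:R)^-1.
Proof.
rewrite ComplexField.Normc.normcV -(rmorph_nat (real_complex R)) normcC.
by rewrite ger0_norm // ler0n.
Qed.

Lemma average_scalar N (gamma : 'I_N -> G) c : (0 < N)%N ->
  average gamma (c *: idfun) = c *: idfun.
Proof.
move=> N0; apply: funext => f; rewrite averageE.
rewrite (eq_bigr (fun=> c *: f)); last first.
  move=> j _; rewrite opZE (linear_opZ (@left_regular_linear _ _ _)).
  rewrite -[lam _ (idfun _)]/((lam (gamma j) \o lam (gamma j)^-1%g) f).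
  by rewrite -left_regularM mulgV left_regular1.
have -> : \sum_(j < N) c *: f = N%:R *: (c *: f).
  by rewrite sumr_const card_ord scaler_nat.
rewrite (scalerA N%:R^-1) mulVf ?scale1r //.
by rewrite pnatr_eq0 -lt0n.
Qed.

Lemma op_le_average N (gamma : 'I_N -> G) T M : (0 < N)%N -> op_le T M ->
  op_le (average gamma T) M.
Proof.
move=> N0 hT f; rewrite averageE ell2_normZ normc_natV.
have Np : 0 < N%:R :> R by rewrite ltr0n.
rewrite ler_pdivrMl //; apply: le_trans (ell2_norm_sum _ _) _.
apply: (@le_trans _ _ (\sum_(j < N) M * ell2_norm f)).
  apply: ler_sum => j _; rewrite left_regular_norm; apply: le_trans (hT _) _.
  by rewrite left_regular_norm.
by rewrite sumr_const card_ord [leRHS]mulr_natl.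
Qed.

(* If x moves C into D, then x u = P_D (x u) + P_(~D) (x (P_D u)); conjugating by the
   gamma_j makes the projections P_D pairwise orthogonal, so that the sum over j
   grows like sqrt N instead of N. *)
Lemma powers_sum_le (C D : set G) (m : nat) (gamma : 'I_(m * m) -> G)
    (s : seq (R[i] * G)) M u :
  (0 < m)%N -> 0 <= M ->
  C `|` D = [set: G] ->
  (forall p, p \in s -> translate p.2 C `&` C = set0) ->
  (forall j k, j != k -> translate (gamma j) D `&` translate (gamma k) D = set0) ->
  op_le (\sum_(p <- s) p.1 *: lam p.2) M ->
  ell2_norm (\sum_j lam (gamma j) ((\sum_(p <- s) p.1 *: lam p.2) (lam (gamma j)^-1%g u)))
    <= 2 * M * m%:R * ell2_norm u.
Proof.
move=> m0 M0 CD sC disj; set x := \sum_(p <- s) _ => hx.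
pose Dj j := translate (gamma j) D.
pose xj j v := lam (gamma j) (x (lam (gamma j)^-1%g v)).
have xj_le j v : ell2_norm (xj j v) <= M * ell2_norm v.
  by rewrite left_regular_norm; apply: le_trans (hx _) _; rewrite left_regular_norm.
have xjE j v y : xj j v y =
    \sum_(p <- s) p.1 * v (gamma j * (p.2^-1 * ((gamma j)^-1 * y)))%g.
  rewrite /xj left_regularE /x op_sumE ell2_sumE; apply: eq_bigr => p _.
  by rewrite opZE ell2ZE !left_regularE invgK.
have split_xj j : xj j u = restr (Dj j) (xj j u) + restr (~` Dj j) (xj j (restr (Dj j) u)).
  apply: ell2P => y; rewrite ell2DE !restrE in_setC.
  have [yD|yD] := boolP (y \in Dj j); first by rewrite addr0.
  rewrite add0r !xjE; rewrite big_seq [RHS]big_seq; apply: eq_bigr => p ps.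
  congr (_ * _); rewrite restrE ifT //; apply/mem_set.
  exists (p.2^-1 * ((gamma j)^-1 * y))%g => //.
  have yC : C ((gamma j)^-1 * y)%g.
    have : (C `|` D) ((gamma j)^-1 * y)%g by rewrite CD.
    case=> // hD; exfalso; move/negP: yD; apply; apply/mem_set.
    by exists ((gamma j)^-1 * y)%g => //; rewrite mulVKg.
  have : (C `|` D) (p.2^-1 * ((gamma j)^-1 * y))%g by rewrite CD.
  case=> // hC; exfalso.
  have := sC p ps; apply/eqP/set0P; exists ((gamma j)^-1 * y)%g; split => //.
  by exists (p.2^-1 * ((gamma j)^-1 * y))%g => //; rewrite mulVKg.
rewrite (eq_bigr (fun j => restr (Dj j) (xj j u) +
   restr (~` Dj j) (xj j (restr (Dj j) u)))); last by move=> j _; apply: split_xj.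
rewrite big_split; apply: le_trans (ell2_normD _ _) _.
have -> : 2 * M * m%:R * ell2_norm u = m%:R * (M * ell2_norm u) + M * (m%:R * ell2_norm u).
  by ring.
have u0 := ell2_norm_ge0 u.
(* In the first sum the outputs have disjoint supports, in the second the inputs [restr (Dj j) u]
   do; either way m^2 terms cost only a factor m. *)
apply: lerD.
  rewrite -(@ler_pXn2r _ 2) ?nnegrE ?ell2_norm_ge0 ?mulr_ge0 ?ler0n //.
  apply: le_trans (norm_sum_restr disj _) _.
  apply: (@le_trans _ _ (\sum_(j < m * m) (M * ell2_norm u) ^+ 2)).
    apply: ler_sum => j _; rewrite ler_pXn2r ?nnegrE ?ell2_norm_ge0 //.
    by rewrite mulr_ge0.
  by rewrite sumr_const card_ord [leRHS]exprMn -natrX mulr_natl mulnn.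
apply: le_trans (ell2_norm_sum _ _) _.
apply: (@le_trans _ _ (\sum_j M * ell2_norm (restr (Dj j) u))).
  by apply: ler_sum => j _; apply: le_trans (restr_norm _ _) _.
rewrite -mulr_sumr ler_wpM2l //.
apply: sum_le_of_sqr => //; exact: sum_restr_norm disj _.
Qed.

Lemma powers_average_small (s : seq (R[i] * G)) (e : R) : powers_group G ->
  (forall p, p \in s -> p.2 != 1%g) -> 0 < e ->
  exists N (gamma : 'I_N -> G), (0 < N)%N /\
    op_le (average gamma (\sum_(p <- s) p.1 *: lam p.2)) e.
Proof.
move=> [_ pG] s1 e0.
have [M M0 hM] : exists2 M, 0 <= M & op_le (\sum_(p <- s) p.1 *: lam p.2) M.
  by apply: span_bounded; exists s.
(* Dividing the bound 2 M m on the sum by the number m^2 of conjugates leaves 2 M / m, to be at most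
   e. *)
have [m m0 hm] : exists2 m, (0 < m)%N & 2 * M <= e * m%:R.
  exists (Num.bound (2 * M / e)).+1 => //; rewrite [leRHS]mulrC -ler_pdivrMr //.
  have h : 0 <= 2 * M / e by rewrite !mulr_ge0 ?invr_ge0 // ltW.
  by apply: le_trans (ltW (archi_boundP h)) _; rewrite ler_nat.
have finF : finite_set [set` [seq p.2 | p <- s]] by apply: finite_seq.
have F1 : ~ [set` [seq p.2 | p <- s]] 1%g.
  by move=> /= /mapP[p ps e1]; have := s1 p ps; rewrite -e1 eqxx.
have mm0 : (1 <= m * m)%N by rewrite muln_gt0 m0.
have [D [D' [gamma [CD _ hF disj]]]] := pG _ (m * m)%N finF F1 mm0.
exists (m * m)%N, gamma; split => // u; rewrite averageE ell2_normZ normc_natV.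
have mp : 0 < (m * m)%:R :> R by rewrite ltr0n.
rewrite ler_pdivrMl //.
have hs p : p \in s -> translate p.2 D `&` D = set0.
  by move=> ps; apply: hF => /=; apply: map_f.
apply: le_trans (powers_sum_le u m0 M0 CD hs disj hM) _.
rewrite natrM mulrA ler_wpM2r ?ell2_norm_ge0 // [leRHS]mulrC [leRHS]mulrA.
by rewrite ler_wpM2r // ler0n.
Qed.

Lemma canonical_traceE T : tau0 T = T (delta R 1%g) 1%g.
Proof. by rewrite /canonical_trace /subgroup_trace big_seq1. Qed.

Lemma span_split_trace S : span S -> exists s : seq (R[i] * G),
  (forall p, p \in s -> p.2 != 1%g) /\
  S = tau0 S *: idfun + \sum_(p <- s) p.1 *: lam p.2.
Proof.
move=> sS; elim/span_ind: S / sS => [|c g S sS [s [hs e]]].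
  by exists [::]; split => //; rewrite big_nil canonical_traceE scale0r addr0.
have tE : tau0 (c *: lam g + S) = c * (1%g == g)%:R + tau0 S.
  by rewrite !canonical_traceE opDE opZE ell2DE ell2ZE left_regular_delta mulg1 deltaE.
have [g1|g1] := eqVneq g 1%g.
  exists s; split => //; rewrite tE g1 eqxx mulr1 scalerDl -addrA -e.
  by rewrite left_regular1.
exists ((c, g) :: s); split.
  by move=> p; rewrite inE => /orP[/eqP -> //|]; apply: hs.
by rewrite tE eq_sym (negbTE g1) mulr0 add0r big_cons addrCA -e.
Qed.

Lemma delta_norm (g : G) : ell2_norm (delta R g) = 1.
Proof.
have := dotff (delta R g); rewrite dot_delta deltaE eqxx => -[] h.
by apply: (@pexpIrn _ 2); rewrite ?nnegrE ?ell2_norm_ge0 // expr1n.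
Qed.

Lemma canonical_trace_le T M : op_le T M -> normc (tau0 T) <= M.
Proof.
move=> hT; rewrite canonical_traceE; apply: le_trans (ell2_norm_at _ _) _.
by apply: le_trans (hT _) _; rewrite delta_norm mulr1.
Qed.

Lemma powers_averaging T (e : R) : powers_group G -> A T -> 0 < e ->
  exists N (gamma : 'I_N -> G), (0 < N)%N /\
    op_le (average gamma T - tau0 T *: idfun) e.
Proof.
(* Three errors of size e/3: the average of T - S, the average of the trace-free part of S, and the
   change of trace from T to S. *)
move=> pG AT e0; have e3 : 0 < e / 3 by rewrite divr_gt0.
have [S sS hS] := Cstar_approx AT e3.
have [s [hs eS]] := span_split_trace sS.
have [N [gamma [N0 hx]]] := powers_average_small pG hs e3.
exists N, gamma; split => //; set x := \sum_(p <- s) _ in hx eS.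
have -> : average gamma T - tau0 T *: idfun =
    average gamma (T - S) + average gamma x + (- tau0 (T - S)) *: idfun.
  have -> : average gamma T = average gamma (T - S) + average gamma S.
    by rewrite -averageD subrK.
  rewrite [in average gamma S]eS (averageD gamma (tau0 S *: idfun)) average_scalar //.
  have -> : - tau0 (T - S) = tau0 S - tau0 T.
    by rewrite !canonical_traceE opDE opNE ell2BE opprB.
  rewrite scalerBl -!addrA; congr (_ + _).
  by rewrite addrCA.
have -> : e = e / 3 + e / 3 + e / 3 * 1 by field.
apply: op_leD; first by apply: op_leD => //; apply: op_le_average.
apply: (@op_leW _ _ _ (normc (- tau0 (T - S)) * 1)).
  by rewrite !mulr1 normcN canonical_trace_le.
by apply: op_leZ => f; rewrite mul1r.
Qed.

Lemma average_Cstar N (gamma : 'I_N -> G) T : A T -> A (average gamma T).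
Proof.
move=> AT; apply: CstarZ; apply: Cstar_sum => j.
exact: (CstarM (CstarM (Cstar_lam R (gamma j)) AT) (Cstar_lam R (gamma j)^-1%g)).
Qed.

Lemma trace_average tau N (gamma : 'I_N -> G) T : normalized_trace tau ->
  (0 < N)%N -> A T -> tau (average gamma T) = tau T.
Proof.
move=> tr N0 AT.
have AJ j : A (lam (gamma j) \o T \o lam (gamma j)^-1%g).
  exact: (CstarM (CstarM (Cstar_lam R (gamma j)) AT) (Cstar_lam R (gamma j)^-1%g)).
rewrite /average (traceZ tr _ (Cstar_sum _ AJ)).
have -> : tau (\sum_j (lam (gamma j) \o T \o lam (gamma j)^-1%g)) = \sum_(j < N) tau T.
  elim: (index_enum _) => [|j r IH]; first by rewrite !big_nil (trace0 tr).
  rewrite !big_cons (traceD tr (AJ j) (Cstar_sum r AJ)) IH; congr (_ + _).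
  rewrite -compA (traceC tr (Cstar_lam R _) (CstarM AT (Cstar_lam R _))).
  by rewrite -compA -left_regularM mulVg left_regular1.
rewrite sumr_const card_ord -[X in _ * X]mulr_natl mulKf //.
by rewrite pnatr_eq0 -lt0n.
Qed.

Lemma powers_unique_trace : powers_group G -> reduced_Cstar_unique_trace R G.
Proof.
move=> pG; exists tau0; split; first exact: canonical_trace_normalized.
move=> tau tr T AT; apply/eqP; rewrite -subr_eq0; apply/eqP.
apply: (@complex_eq0_eps _ _ 4) => e e0.
have [N [gamma [N0 hN]]] := powers_averaging pG AT e0.
have Aa := average_Cstar gamma AT.
have At := CstarZ (tau0 T) (Cstar_id R G).
have := trace_le tr (CstarB Aa At) e0 hN.
rewrite (traceB tr Aa At) (trace_average gamma tr N0 AT) (traceZ tr _ (Cstar_id R G)).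
rewrite (trace1 tr) mulr1 mulrC => h.
by have [h1 h2] := ReIm_le_normc (tau T - tau0 T); split; apply: le_trans h.
Qed.

(** The vector [delta R 1] is separating: by right translation T kills every delta, hence so does
    its adjoint S, and the coordinates of T f are the products of f with the S (delta y). *)
Lemma Cstar_eq0 T : A T -> T (delta R 1%g) = 0 -> T = 0.
Proof.
move=> AT T0; have [S AS adj] := Cstar_adjoint AT.
have Td x : T (delta R x) = 0.
  have -> : delta R x = right_translate x^-1%g (delta R 1%g).
    by rewrite right_translate_delta invgK mul1g.
  by rewrite Cstar_right_translate // T0; apply: ell2P.
have Sd y : S (delta R y) = 0.
  by apply: ell2P => x; rewrite -dot_delta (adjoint_sym adj) Td dotC dot0l conjC0.
apply: funext => f; apply: ell2P => y.
by rewrite -dot_delta adj Sd dotC dot0l conjC0.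
Qed.

Section Ideal.
Variable I : set op.
Hypothesis idI : closed_ideal I.

Lemma idealZ c T : I T -> I (c *: T).
Proof. by move=> IT; have := ideal_linear idI c IT (ideal0 idI); rewrite addr0. Qed.

Lemma idealD S T : I S -> I T -> I (S + T).
Proof. by move=> IS IT; have := ideal_linear idI 1 IS IT; rewrite scale1r. Qed.

Lemma ideal_average N (gamma : 'I_N -> G) T : I T -> I (average gamma T).
Proof.
move=> IT; apply: idealZ; elim: (index_enum _) => [|j r IH].
  by rewrite big_nil; apply: ideal0.
rewrite big_cons; apply: idealD IH; apply: (ideal_mulr idI _ (Cstar_lam R _)).
exact: (ideal_mull idI (Cstar_lam R _) IT).
Qed.

(* Partial sums of the Neumann series of z show that 1 lies in the closure of I. *)
Lemma ideal_near_id z : I z -> op_le (z - idfun) 2^-1 -> I = A.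
Proof.
move=> Iz hz; pose y : op := idfun - z.
have Az := ideal_sub idI Iz.
have Ay : A y by exact: (CstarB (Cstar_id R G) Az).
have hy : op_le y 2^-1 by rewrite /y -opprB; apply: op_leN.
pose yn n : op := iter n (fun T => y \o T) idfun.
have yS n : yn n.+1 = y \o yn n by [].
have Ayn n : A (yn n).
  elim: n => [|n IH]; first exact: (Cstar_id R G).
  exact: (CstarM Ay IH).
have hyn n : op_le (yn n) (2^-1 ^+ n).
  elim: n => [|n IH]; first by move=> f; rewrite expr0 mul1r.
  by rewrite yS exprS; apply: op_le_comp; rewrite // invr_ge0.
have Iyn n : I (idfun - yn n).
  elim: n => [|n IH]; first by rewrite subrr; apply: (ideal0 idI).
  have -> : idfun - yn n.+1 = (idfun - yn n) + (z \o yn n).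
    by apply: funext => f; rewrite yS /y !opE opprD opprK addrA.
  exact: (idealD IH (ideal_mulr idI Iz (Ayn n))).
have Iid : I idfun.
  apply: (ideal_closed idI); split; first by case: (Cstar_id R G).
  move=> e e0; have [n hn] := half_exp_small 1 e0; rewrite mul1r in hn.
  exists (idfun - yn n); split => // f.
  have -> : idfun f - (idfun - yn n) f = yn n f by rewrite !opE opprB addrCA subrr addr0.
  by apply: (op_leW (ltW hn)).
apply/seteqP; split => [T|T AT]; first exact: (ideal_sub idI).
exact: (ideal_mull idI AT Iid).
Qed.

End Ideal.

Lemma powers_simple : powers_group G -> reduced_Cstar_simple R G.
Proof.
move=> pG I idI.
have [[T [IT T0]]|noT] := pselect (exists T, I T /\ T <> 0); last first.
  left; apply/seteqP; split => [T IT|_ ->]; last exact: (ideal0 idI).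
  by apply: contrapT => T0; apply: noT; exists T.
right; have AT := ideal_sub idI IT.
have [g Tg] : exists g, T (delta R 1%g) g != 0.
  apply: contrapT => no; apply: T0; apply: (Cstar_eq0 AT).
  by apply: ell2P => g; apply/eqP; apply: contra_notT no => h; exists g.
(* Translation by g^-1 moves a nonzero coefficient of T to the unit of G, and rescaling makes the
   canonical trace 1. Averages of T' then come close to the identity. *)
pose T' : op := (T (delta R 1%g) g)^-1 *: (lam g^-1%g \o T).
have IT' : I T' by apply: (idealZ idI); exact: (ideal_mull idI (Cstar_lam R _) IT).
have t1 : tau0 T' = 1.
  rewrite canonical_traceE /T' opZE opME ell2ZE left_regularE invgK mulg1.
  by rewrite mulVf.
have h2 : 0 < 2^-1 :> R by rewrite invr_gt0.
have [N [gamma [N0 hN]]] := powers_averaging pG (ideal_sub idI IT') h2.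
rewrite t1 scale1r in hN.
exact: (ideal_near_id idI (ideal_average idI gamma IT') hN).
Qed.

End Averaging.

(** * Powers groups *)

Section PowersGroups.
Variable G : groupType.
Implicit Types (H : set G).

(** If the class of g is finite, it can serve as F. All conjugates of g then move C off itself, so g
    maps gamma_k D into gamma_j D whenever j and k differ. With three indices, g gamma_1 D lies in
    the disjoint sets gamma_0 D and gamma_2 D; hence D is empty and C = G, which g cannot move off
    itself. *)
Lemma powers_icc : powers_group G -> icc G.
Proof.
move=> [_ pG] g g1 fin.
have F1 : ~ conj_class g 1%g.
  by move=> [x _ /eqP]; rewrite conjg_eq1; apply/negP.
have [C [D [gam [CD CD0 hF disj]]]] := pG _ 3%N fin F1 isT.
have CDx x : (C `|` D) x by rewrite CD.
have inD x : ~ C x -> D x by case: (CDx x).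
have inC x : ~ D x -> C x by case: (CDx x).
have step (j k : 'I_3) d : j != k -> D d -> translate (gam j) D (g * (gam k * d))%g.
  move=> jk Dd; exists ((gam j)^-1 * (g * (gam k * d)))%g; last by rewrite mulVKg.
  apply: inD => Cx.
  have Cy : C ((gam j)^-1 * (gam k * d))%g.
    apply: inC => Dy; have := disj j k jk; apply/eqP/set0P.
    exists (gam k * d)%g; split; last by exists d.
    by exists ((gam j)^-1 * (gam k * d))%g => //; rewrite mulVKg.
  have Fg : conj_class g (g ^ gam j)%g by exists (gam j).
  have := hF _ Fg; apply/eqP/set0P; exists ((gam j)^-1 * (g * (gam k * d)))%g; split => //.
  exists ((gam j)^-1 * (gam k * d))%g => //.
  by rewrite /conjg -!mulgA mulVKg.
have noD d : ~ D d.
  move=> Dd; have := disj (inord 0) (inord 2); rewrite -val_eqE /= !inordK // => /(_ isT).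
  apply/eqP/set0P; exists (g * (gam (inord 1) * d))%g.
  by split; apply: step => //; rewrite -val_eqE /= !inordK.
have Fg : conj_class g g by exists 1%g => //; rewrite conjg1.
have := hF _ Fg; apply/eqP/set0P; exists g; split; last exact/inC/noD.
by exists 1%g; [exact/inC/noD | rewrite mulg1].
Qed.

Lemma icc_finite_normal H : icc G -> normal_subgroup H -> finite_set H -> H = [set 1%g].
Proof.
move=> iccG nH finH; apply/seteqP; split => [h Hh|_ ->]; last exact: normal_subgroup1.
apply: contrapT => /eqP h1; apply: (iccG h h1); apply: sub_finite_set finH.
by move=> _ [x _ <-]; apply: normal_subgroupJ.
Qed.

(** For h <> 1 in H, the part of H in gamma_j C is moved off itself by a conjugate of h, which lies
    in H, so its measure is at most 1/2. The parts of H in the three disjoint sets gamma_j D then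
    have measure at least 1/2 each, against a total of 1. The gamma_j need not preserve the measure;
    only elements of H are used to translate. *)
Lemma powers_no_amenable (R : realType) H : powers_group G ->
  normal_subgroup H -> amenable R H -> H = [set 1%g].
Proof.
move=> [_ pG] nH [m [m1 m0 mD mT]].
apply/seteqP; split => [h Hh|_ ->]; last exact: normal_subgroup1.
apply: contrapT => h1.
have F1 : ~ [set h] 1%g by move=> /= e; apply: h1.
have [C [D [gam [CD CD0 hF disj]]]] := pG _ 3%N (finite_set1 h) F1 isT.
have mono A : A `<=` H -> m A <= 1.
  move=> AH; have AC : H `\` A `<=` H by move=> x [].
  have AA : A `&` (H `\` A) = set0 by apply/seteqP; split => // x [Ax []].
  have := mD _ _ AH AC AA; rewrite setDUK // m1 => ->.
  by rewrite lerDl m0.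
pose E j := [set x | H x /\ C ((gam j)^-1 * x)%g].
pose E' j := [set x | H x /\ D ((gam j)^-1 * x)%g].
have EH j : E j `<=` H by move=> x [].
have EH' j : E' j `<=` H by move=> x [].
have half j : 1 <= 2 * m (E' j).
  pose k := (h ^ (gam j)^-1)%g.
  have Hk : H k by apply: normal_subgroupJ.
  have kE : translate k (E j) `<=` H by move=> _ [x [Hx _] <-]; apply: normal_subgroupM.
  have dis : translate k (E j) `&` E j = set0.
    apply/seteqP; split => // _ [[y [Hy Cy] <-] [_ Cky]].
    have := hF h erefl; apply/eqP/set0P; exists (h * ((gam j)^-1 * y))%g; split.
      by exists ((gam j)^-1 * y)%g.
    by move: Cky; rewrite /k /conjg invgK -!mulgA mulKg.
  have e1 : m (translate k (E j) `|` E j) = m (E j) + m (E j) by rewrite mD // mT.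
  have u1 : m (translate k (E j) `|` E j) <= 1 by apply: mono; rewrite subUset.
  have e2 : m (E j `|` E' j) = m (E j) + m (E' j).
    apply: mD => //; apply/seteqP; split => // x [[_ Cx] [_ Dx]].
    by have : (C `&` D) ((gam j)^-1 * x)%g by []; rewrite CD0.
  have e3 : E j `|` E' j = H.
    apply/seteqP; split => [x [/EH|/EH']//|x Hx].
    have : (C `|` D) ((gam j)^-1 * x)%g by rewrite CD.
    by case=> ?; [left|right].
  by rewrite e3 m1 in e2; lra.
have disE j k : j != k -> E' j `&` E' k = set0.
  move=> jk; apply/seteqP; split => // x [[_ Dj] [_ Dk]].
  have := disj j k jk; apply/eqP/set0P; exists x.
  by split; [exists ((gam j)^-1 * x)%g | exists ((gam k)^-1 * x)%g]; rewrite ?mulVKg.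
pose i0 : 'I_3 := inord 0; pose i1 : 'I_3 := inord 1; pose i2 : 'I_3 := inord 2.
have e1 : m (E' i0 `|` E' i1) = m (E' i0) + m (E' i1).
  by apply: mD => //; apply: disE; rewrite -val_eqE /= !inordK.
have e2 : m (E' i0 `|` E' i1 `|` E' i2) = m (E' i0 `|` E' i1) + m (E' i2).
  apply: mD => //; first by rewrite subUset.
  by rewrite setIUl !disE ?setU0 // -val_eqE /= !inordK.
have u1 : m (E' i0 `|` E' i1 `|` E' i2) <= 1 by apply: mono; rewrite !subUset.
have := half i0; have := half i1; have := half i2; lra.
Qed.

Lemma finite_amenable (R : realType) H : normal_subgroup H -> finite_set H -> amenable R H.
Proof.
move=> nH /finite_seqP[s0 Hs0]; pose s := undup s0.
have us : uniq s := undup_uniq s0.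
have Hs : H = [set` s].
  by rewrite Hs0; apply/seteqP; split => x /=; rewrite mem_undup.
have s1 : 0 < (size s)%:R :> R.
  rewrite ltr0n; have := subgroup_mem1 nH Hs; by case: (s).
pose c (A : set G) : R := \sum_(x <- s) (x \in A)%:R.
exists (fun A => (size s)%:R^-1 * c A); split.
- rewrite /c big_seq (eq_bigr (fun=> 1)); last by move=> x xs; rewrite mem_set // Hs.
  by rewrite -big_seq big_const_seq count_predT iter_addr_0 mulVf // gt_eqF.
- by move=> A _; rewrite mulr_ge0 ?invr_ge0 ?ler0n // sumr_ge0.
- move=> A B _ _ AB; rewrite -mulrDr -big_split /=; congr (_ * _).
  apply: eq_bigr => x _; rewrite -natrD; congr (_%:R).
  rewrite in_setU; case: (boolP (x \in A)) => //= xA.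
  case: (boolP (x \in B)) => //= xB.
  have : (A `&` B) x by split; apply: set_mem.
  by rewrite AB.
- move=> h A Hh _; congr (_ * _); rewrite /c.
  have hs : h \in s by apply/(subgroup_memP Hs).
  rewrite (eq_bigr (fun x => ((h^-1 * x)%g \in A)%:R)); last first.
    move=> x _; congr (nat_of_bool _)%:R; apply/idP/idP => /set_mem.
      by move=> [a Aa <-]; rewrite mulKg; apply: mem_set.
    by move=> hA; apply: mem_set; exists (h^-1 * x)%g => //; rewrite mulVKg.
  rewrite -(big_map (fun x => h^-1 * x)%g predT (fun x => (x \in A)%:R)); apply: perm_big.
  apply: uniq_perm => //; first by rewrite map_inj_uniq //; apply: mulgI.
  move=> x; apply/mapP/idP => [[y ys ->]|xs].
    by rewrite (subgroup_memC nH Hs) (subgroup_memMr nH Hs) // (subgroup_memV nH Hs).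
  exists (h * x)%g; last by rewrite mulKg.
  by rewrite (subgroup_memC nH Hs) (subgroup_memMr nH Hs).
Qed.

End PowersGroups.

(** * Convergence actions *)

Lemma infinite_injective_seq (T : Type) (A : set T) : infinite_set A ->
  exists2 u : nat -> T, injective u & forall n, A (u n).
Proof.
move=> /infiniteP /card_leP[f].
exists (fun n => \val (f (exist _ n (mem_set (I : [set: nat] n))))).
  move=> m n /val_inj e.
  have : (exist _ m (mem_set (I : [set: nat] m)) : {x : nat | x \in [set: nat]}) =
      exist _ n (mem_set (I : [set: nat] n)).
    by apply: (@inj _ _ _ f) e; rewrite inE.
  by move=> /(congr1 (@proj1_sig _ _)).
by move=> n; apply/set_mem/(valP (f _)).
Qed.

Section Dynamics.
Variables (R : realType) (G : groupType) (X : metricType R) (rho : G -> X -> X).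
Hypothesis conv : convergence_action rho.

Lemma act_cont g : continuous (rho g).
Proof. by have [+ _] := conv_homeo conv => /(_ g) [f' []]. Qed.

Lemma act_inj g : injective (rho g).
Proof. by have [+ _] := conv_homeo conv => /(_ g) [f' [/can_inj]]. Qed.

Lemma actM g h x : rho (g * h)%g x = rho g (rho h x).
Proof. by have [_ ->] := conv_homeo conv. Qed.

Lemma act1 x : rho 1%g x = x.
Proof. by apply: (@act_inj 1%g); rewrite -actM mulg1. Qed.

Lemma actK g x : rho g^-1%g (rho g x) = x.
Proof. by rewrite -actM mulVg act1. Qed.

Lemma actKV g x : rho g (rho g^-1%g x) = x.
Proof. by rewrite -actM mulgV act1. Qed.

Lemma act_nbhs g x (W : set X) : nbhs (rho g x) W -> nbhs x (rho g @^-1` W).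
Proof. exact: act_cont. Qed.

Lemma separated (x y : X) : x != y ->
  exists U V : set X, [/\ nbhs x U, nbhs y V & U `&` V = set0].
Proof.
have := @metric_hausdorff R X; rewrite open_hausdorff => /[apply].
move=> [[U V] /= [xU yV] [oU oV /eqP UV]]; exists U, V; split => //.
  exact: open_nbhs_nbhs (conj oU (set_mem xU)).
exact: open_nbhs_nbhs (conj oV (set_mem yV)).
Qed.

Lemma eq_of_nbhs (x y : X) : (forall W, nbhs y W -> W x) -> x = y.
Proof.
move=> h; apply: contrapT => /eqP /separated[U [V [xU yV UV]]].
have : (U `&` V) x by split; [exact: nbhs_singleton | exact: h].
by rewrite UV.
Qed.

Lemma conv_attract u r a (K W : set X) : convergence_seq rho u r a ->
  compact K -> ~ K r -> nbhs a W -> \forall n \near \oo, forall x, K x -> W (rho (u n) x).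
Proof.
move=> [_ /fam_cvgP cv _] cK Kr /nbhs_ballP[e /= e0 eW].
have fK : compactly_in (~` [set r]) K by split => // x Kx xr; apply: Kr; rewrite -xr.
pose P := [set h : X -> X | forall y, K y -> ball a e (h y)].
have nP : nbhs ((fun=> a) : {uniform` K -> X}) P.
  apply/uniform_nbhs; exists [set p | ball p.1 e p.2]; split; last by [].
  exact: entourage_ball (PosNum e0).
have ev : \forall n \near \oo, P (rho (u n)) := cv K fK P nP.
by apply: filterS ev => n h x Kx; apply: eW; apply: h.
Qed.

Lemma conv_eventually_fixed u r a x : convergence_seq rho u r a -> x <> r ->
  (\forall n \near \oo, rho (u n) x = x) -> x = a.
Proof.
move=> cs xr fx; apply: eq_of_nbhs => W aW.
have h := conv_attract cs (@compact_set1 _ x) (fun e => xr (esym e)) aW.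
near \oo => n.
have <- : rho (u n) x = x by near: n.
by have /(_ x erefl) : forall y, [set x] y -> W (rho (u n) y) by near: n.
Unshelve. all: by end_near. Qed.

(** A convergence sequence inside the kernel would consist of identity maps, forcing every point
    other than r to equal a; this contradicts the presence of three points. *)
Lemma kernel_finite : finite_set [set g | rho g = id].
Proof.
apply: contrapT => /infinite_injective_seq[v vi vk].
have [phi [r [a [_ cs]]]] := conv_subseq conv vi.
have key x : x <> r -> x = a.
  move=> xr; apply: (conv_eventually_fixed cs) => //.
  by near=> n; rewrite /= vk.
have [x [y [z [xy yz xz]]]] := conv_three_points conv.
have [xr|/eqP xr] := eqVneq x r.
  have ya : y = a by apply: key => yr; move: xy; rewrite xr yr eqxx.
  have za : z = a by apply: key => zr; move: xz; rewrite xr zr eqxx.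
  by move: yz; rewrite ya za eqxx.
have xa := key x xr.
have [yr|/eqP yr] := eqVneq y r.
  have za : z = a by apply: key => zr; move: yz; rewrite yr zr eqxx.
  by move: xz; rewrite xa za eqxx.
by move: xy; rewrite xa (key y yr) eqxx.
Unshelve. all: by end_near. Qed.

Lemma kernel_normal : normal_subgroup [set g | rho g = id].
Proof.
split => /=.
- by apply: funext => x; apply: act1.
- by move=> g h hg hh; apply: funext => x; rewrite actM hg hh.
- by move=> g hg; apply: funext => x; rewrite -{2}(actK g x) hg.
- by move=> g h hg; apply: funext => x; rewrite /conjg !actM hg actK.
Qed.

Lemma trivial_kernel_effective : [set g | rho g = id] = [set 1%g] -> effective rho.
Proof.
move=> k1 g h gh; apply: divg1_eq.
suff : [set g | rho g = id] (g / h)%g by rewrite k1.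
by apply: funext => x; rewrite actM gh actKV.
Qed.

Hypothesis min : minimal_action rho.
Hypothesis nonel : non_elementary rho.

Lemma space_infinite : infinite_set [set: X].
Proof. by apply: sub_infinite_set nonel. Qed.

Lemma exists_conv_seq : exists u r a, convergence_seq rho u r a.
Proof.
apply: contrapT => no; apply: nonel.
rewrite (_ : limit_set rho = set0); first exact: finite_set0.
apply/seteqP; split => // x [u [r [a [cs _]]]]; apply: no.
by exists u, r, a.
Qed.

Lemma transport x (U : set X) : open U -> U !=set0 -> exists g, U (rho g x).
Proof.
by move=> oU U0; have [y [Uy [g _ gy]]] := min x U0 oU; exists g; rewrite gy.
Qed.

(** A finite orbit is closed, and dense by minimality, so it would be the whole infinite space. *)
Lemma orbit_infinite x : infinite_set [set rho g x | g in [set: G]].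
Proof.
move=> fin; apply: space_infinite; apply: (sub_finite_set _ fin) => y _.
apply: contrapT => ny.
have cl : closed [set rho g x | g in [set: G]].
  have acc := hausdorff_accessible (@metric_hausdorff R X).
  exact: (iffLR accessible_finite_set_closed acc _ fin).
have [] := min x (ex_intro _ y ny) (closed_openC cl).
by move=> z [].
Qed.

(* A convergence sequence precomposed so that its repelling point lies in U pushes
   the complement of U into arbitrarily small neighbourhoods of its attracting point. *)
Lemma contracting_sequence (U : set X) : open U -> U !=set0 ->
  exists (v : nat -> G) (a : X), forall W, nbhs a W ->
    \forall n \near \oo, forall x, ~ U x -> W (rho (v n) x).
Proof.
move=> oU U0; have [u [r [a cs]]] := exists_conv_seq.
have [t Ut] := transport r oU U0.
exists (fun n => u n * t^-1)%g, a => W aW.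
have cK : compact (rho t^-1%g @` (~` U)).
  apply: continuous_compact; first exact/continuous_subspaceT/act_cont.
  apply: (subclosed_compact _ (conv_compact conv)) => //.
  exact: open_closedC.
have Kr : ~ (rho t^-1%g @` (~` U)) r.
  by move=> [x Ux xr]; apply: Ux; rewrite -(actKV t x) xr.
apply: filterS (conv_attract cs cK Kr aW) => n h x Ux.
by rewrite actM; apply: h; exists x.
Qed.

Lemma pingpong (U : set X) N : open U -> U !=set0 ->
  exists gam : 'I_N -> G, forall j k x y, j != k -> ~ U x -> ~ U y ->
    rho (gam j) x <> rho (gam k) y.
Proof.
move=> oU U0; have [v [a hv]] := contracting_sequence oU U0.
have [p pi pO] := infinite_injective_seq (@orbit_infinite a).
have /choice[g hg] : forall j, exists g, rho g a = p j.
  by move=> j; have [g _ e] := pO j; exists g.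
(* Only pairs of points in the orbit of a need separating: [g j] and [g k] pull disjoint
   neighbourhoods of p j and p k back to one neighbourhood of a. There are finitely many pairs, so
   one n serves them all. *)
have ev : \forall n \near \oo, forall jk : 'I_N * 'I_N, jk.1 != jk.2 ->
    forall x y, ~ U x -> ~ U y -> rho (g jk.1 * v n)%g x <> rho (g jk.2 * v n)%g y.
  apply: filter_forall => -[j k] /=.
  have [->|jk] := eqVneq j k; first by near=> n.
  have : p j != p k by apply: contra jk => /eqP/pi/val_inj ->.
  rewrite -!hg => /separated[A [B [aA bB AB]]].
  have W : nbhs a (rho (g j) @^-1` A `&` rho (g k) @^-1` B).
    by apply: filterI; apply: act_nbhs.
  apply: filterS (hv _ W) => n h _ x y Ux Uy e.
  have [Ax _] := h x Ux; have [_ By] := h y Uy.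
  have : (A `&` B) (rho (g j * v n)%g x).
    by split; [rewrite actM | rewrite e actM].
  by rewrite AB.
near \oo => n; exists (fun j : 'I_N => g j * v n)%g => j k x y jk Ux Uy.
have h : forall jk : 'I_N * 'I_N, jk.1 != jk.2 ->
    forall x y, ~ U x -> ~ U y -> rho (g jk.1 * v n)%g x <> rho (g jk.2 * v n)%g y.
  by near: n.
exact: (h (j, k) jk).
Unshelve. all: by end_near. Qed.

(** The convergence property applies to injective sequences only, and this extracts one. The bound
    [k <= nk k] keeps eventual statements valid along it. *)
Lemma escaping_subsequence (T : Type) (f : nat -> T) :
  (forall n, \forall m \near \oo, f m <> f n) ->
  exists2 nk : nat -> nat, (forall k, (k <= nk k)%N) & injective (f \o nk).
Proof.
move=> esc.
(* From B on, f avoids all of f 0, ..., f n at once, so iterating B yields pairwise distinct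
   values. *)
have /choice[B hB] : forall n, exists B, (n < B)%N /\
    forall i m, (i <= n)%N -> (B <= m)%N -> f m <> f i.
  elim=> [|n [B [nB hB]]].
    have [M _ hM] := esc 0%N; exists M.+1; split => // i m; rewrite leqn0 => /eqP -> Mm.
    by apply: hM; apply: ltnW.
  have [M _ hM] := esc n.+1; exists (maxn B M).+1; split.
    by rewrite ltnS (leq_trans nB) // leq_maxl.
  move=> i m; rewrite leq_eqVlt ltnS => /orP[/eqP ->|le_in] h.
    by apply: hM => /=; apply: leq_trans (leq_maxr B M) (ltnW h).
  by apply: hB le_in _; apply: leq_trans (leq_maxl B M) (ltnW h).
pose nk k := iter k B 0%N.
have nkS k : nk k.+1 = B (nk k) by [].
have nk_lt i j : (i < j)%N -> (B (nk i) <= nk j)%N.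
  elim: j => // j IH; rewrite ltnS leq_eqVlt => /orP[/eqP ->|/IH h].
    by rewrite nkS.
  by rewrite nkS; apply: leq_trans h _; apply: ltnW; apply: (hB _).1.
exists nk.
  by elim=> // k IH; rewrite nkS; apply: leq_trans (hB _).1.
move=> i j /= e; apply: contrapT => /eqP; rewrite neq_ltn => /orP[] h.
  exact: (hB _).2 (leqnn _) (nk_lt _ _ h) (esym e).
exact: (hB _).2 (leqnn _) (nk_lt _ _ h) e.
Qed.

(* Conjugates of f by a contracting sequence are nontrivial but fix everything outside
   small neighbourhoods of one point, which no convergence sequence can do. *)
Lemma effective_moves f (U : set X) : effective rho -> f != 1%g -> open U -> U !=set0 ->
  exists2 x, U x & rho f x <> x.
Proof.
move=> eff f1 oU U0; apply: contrapT => noU.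
have fixU x : U x -> rho f x = x.
  by move=> Ux; apply: contrapT => h; apply: noU; exists x.
have [v [a hv]] := contracting_sequence oU U0.
pose w n := (v n * f * (v n)^-1)%g.
have wfix x : x <> a -> \forall n \near \oo, rho (w n) x = x.
  move=> /eqP /separated[A [W [xA aW AW]]].
  apply: filterS (hv W aW) => n h.
  have Ux : U (rho (v n)^-1%g x).
    apply: contrapT => /h; rewrite actKV => Wx.
    have : (A `&` W) x by split => //; apply: nbhs_singleton.
    by rewrite AW.
  by rewrite /w !actM fixU // actKV.
have wmove n : exists2 x, x <> a & rho (w n) x <> x.
  apply: contrapT => no.
  have fx x : x <> a -> rho (w n) x = x.
    by move=> xa; apply: contrapT => h; apply: no; exists x.
  (* If a were moved, its image would be another point, hence fixed, contradicting injectivity. *)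
  have fa : rho (w n) a = a.
    by apply: contrapT => h; apply: (h); apply: (@act_inj (w n)); apply: fx.
  have wid : w n = 1%g.
    apply: eff; apply: funext => x; rewrite act1.
    by have [->|/eqP] := eqVneq x a; [exact: fa | exact: fx].
  move: f1; apply/negP; rewrite negbK; apply/eqP.
  have -> : f = ((v n)^-1 * w n * v n)%g by rewrite /w !mulgA mulVg mul1g mulgVK.
  by rewrite wid mulg1 mulVg.
have [nk le_nk inj_nk] : exists2 nk : nat -> nat, (forall k, (k <= nk k)%N) & injective (w \o nk).
  apply: escaping_subsequence => n; have [x xa wx] := wmove n.
  by apply: filterS (wfix x xa) => m h e; apply: wx; rewrite -e.
have [phi [r [b [phi_inc cs]]]] := conv_subseq conv inj_nk.
(* A point other than a is eventually fixed along the subsequence; if it also differs from r, it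
   must be the attracting point b. So X would have at most three points. *)
apply: space_infinite; apply: (@sub_finite_set _ _ [set a; r; b]); last first.
  by rewrite !finite_setU; do !split; apply: finite_set1.
move=> x _; have [->|/eqP xa] := eqVneq x a; first by left; left.
have [->|/eqP xr] := eqVneq x r; first by left; right.
right; apply: (conv_eventually_fixed cs) => //.
have [M _ hM] := wfix x xa; exists M => // n /= Mn; apply: hM => /=.
apply: leq_trans Mn _; apply: leq_trans (le_nk _).
elim: (n) => // m IH; apply: leq_ltn_trans IH _; exact: phi_inc.
Qed.

(** Being moved off itself passes to smaller open sets, so U can be shrunk for one element at a
    time, around a point which that element moves. *)
Lemma effective_wandering (s : seq G) : effective rho -> (forall f, f \in s -> f != 1%g) ->
  exists U : set X, [/\ open U, U !=set0 & forall f, f \in s -> forall x, U x -> ~ U (rho f x)].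
Proof.
move=> eff; elim: s => [|f s IH] s1.
  exists [set: X]; split => //; first exact: openT.
  by have [x _] := conv_three_points conv; exists x.
have [|U [oU U0 hU]] := IH; first by move=> g gs; apply: s1; rewrite inE gs orbT.
have f1 : f != 1%g by apply: s1; rewrite inE eqxx.
have [x Ux fx] := effective_moves eff f1 oU U0.
have : x != rho f x by apply/eqP => e; apply: fx.
have := @metric_hausdorff R X; rewrite open_hausdorff => /[apply].
move=> [[A B] /= [xA fxB] [oA oB /eqP AB]].
exists (U `&` A `&` (rho f @^-1` B)); split.
- apply: openI; first exact: openI.
  by apply: open_comp => // y _; apply: act_cont.
- by exists x; split; [split => //; exact: set_mem | exact: set_mem].
move=> g; rewrite inE => /orP[/eqP ->|gs] y [[Uy Ay] By] [[Ugy Agy] _].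
  have : (A `&` B) (rho f y) by split.
  by rewrite AB.
exact: (hU g gs y).
Qed.

Lemma effective_powers : effective rho -> powers_group G.
Proof.
move=> eff; split.
  have [u [_ [_ [ui _ _]]]] := exists_conv_seq.
  have [u0|u0] := eqVneq (u 0%N) 1%g; last by exists (u 0%N).
  by exists (u 1%N); rewrite -u0; apply/eqP => /ui.
move=> F N /finite_seqP[s ->] F1 _.
have s1 f : f \in s -> f != 1%g by move=> fs; apply/eqP => f1; apply: F1; rewrite /= -f1.
have [U [oU U0 hU]] := effective_wandering eff s1.
have [gam hgam] := pingpong N oU U0.
have [x0 _] := U0.
exists [set g | U (rho g x0)], (~` [set g | U (rho g x0)]), gam; split.
- exact: setUv.
- exact: setICr.
- move=> f fs; apply/seteqP; split => // _ [[g Ug <-]] /=.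
  by rewrite actM; apply: hU.
move=> j k jk; apply/seteqP; split => // _ [[d Dd <-] [d' Dd' e]].
by apply: (hgam j k _ _ jk Dd Dd'); rewrite -!actM e.
Qed.

End Dynamics.

(** * The equivalences *)

Lemma finite_set_uniq_seq (T : choiceType) (H : set T) : finite_set H ->
  exists2 s : seq T, uniq s & H = [set` s].
Proof.
move=> /finite_seqP[s ->]; exists (undup s); first exact: undup_uniq.
by apply/seteqP; split => x /=; rewrite mem_undup.
Qed.

Theorem corollary1p2 (R : realType) (G : groupType) (X : metricType R)
    (rho : G -> X -> X) (countable_G : countable [set: G])
    (conv_rho : convergence_action rho) (min_rho : minimal_action rho)
    (nonelem_rho : non_elementary rho) :
  [<-> (* (i) *) effective rho;
       (* (ii) *) powers_group G;
       (* (iii) *) reduced_Cstar_simple R G;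
       (* (iv) *) reduced_Cstar_unique_trace R G;
       (* (v) *) icc G;
       (* (vi) *) forall H : set G,
                    normal_subgroup H -> amenable R H -> H = [set 1%g];
       (* (vii) *) forall H : set G,
                    normal_subgroup H -> finite_set H -> H = [set 1%g];
       (* (viii) *) forall (Y : metricType R) (sigma : G -> Y -> Y),
                    convergence_action sigma -> minimal_action sigma ->
                    non_elementary sigma -> effective sigma].
Proof.
pose no_finite := forall H : set G, normal_subgroup H -> finite_set H -> H = [set 1%g].
have eff_powers : effective rho -> powers_group G by apply: effective_powers.
have no_finite_eff (Y : metricType R) (sigma : G -> Y -> Y) :
    no_finite -> convergence_action sigma -> effective sigma.
  move=> nf conv_s; apply: (trivial_kernel_effective conv_s).
  by apply: nf; [exact: kernel_normal | exact: kernel_finite].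
have no_finite_powers : no_finite -> powers_group G.
  by move=> nf; apply/eff_powers/no_finite_eff.
have simple_no_finite : reduced_Cstar_simple R G -> no_finite.
  by move=> simple H nH /finite_set_uniq_seq[s us Hs]; apply: simple_trivial_subgroup us simple.
have trace_no_finite : reduced_Cstar_unique_trace R G -> no_finite.
  by move=> ut H nH /finite_set_uniq_seq[s us Hs]; apply: unique_trace_trivial_subgroup us ut.
tfae.
- exact: eff_powers.
- exact: powers_simple.
- by move=> /simple_no_finite/no_finite_powers; apply: powers_unique_trace.
- by move=> /trace_no_finite/no_finite_powers; apply: powers_icc.
- move=> iccG H; apply: powers_no_amenable; apply: no_finite_powers => K.
  exact: icc_finite_normal.
- by move=> no_amen H nH finH; apply: no_amen => //; apply: finite_amenable.
- by move=> nf Y sigma conv_s _ _; apply: no_finite_eff.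
(* (viii) => (i) is the instance at [rho] itself. *)
- exact.
Qed.
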